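(* Let $k$ be a field, and let $F: \mathcal{C} \to \mathcal{D}$ be an exact tensor functor between finite tensor categories over $k$ that has a left adjoint $L$ and a right adjoint $R$ and satisfies the following equivalent conditions: (1) $L$ has a left adjoint; (2) $R$ has a right adjoint; (3) there is an object $\chi_F \in \mathcal{D}$ such that $R \cong L(- \otimes \chi_F)$. Let $\chi_F \in \mathcal{D}$ be the relative modular object of $F$, and let $\alpha_{\mathcal{C}} \in \mathcal{C}$ and $\alpha_{\mathcal{D}} \in \mathcal{D}$ be the modular objects of $\mathcal{C}$ and $\mathcal{D}$. Then $$\alpha_{\mathcal{D}}^* \otimes F(\alpha_{\mathcal{C}}) \cong \chi_F \cong F(\alpha_{\mathcal{C}}) \otimes \alpha_{\mathcal{D}}^*.$$
   Context: $k$ is an arbitrary field. A $k$-linear category is finite if it is $k$-linearly equivalent to the category of finite-dimensional right modules over a finite-dimensional $k$-algebra. A finite tensor category over $k$ is a rigid monoidal category that is a finite abelian category over $k$ and whose tensor product is $k$-linear in each variable (the unit object $\mathbf{1}$ is not assumed simple). A tensor functor is a $k$-linear strong monoidal functor between such categories. The left dual $X^*$ of $X$ comes with $X^* \otimes X \to \mathbf{1}$ and $\mathbf{1} \to X \otimes X^*$. Modular object: for a finite tensor category $\mathcal{C}$, let $\mathrm{Rex}(\mathcal{C})$ be the category of $k$-linear right exact endofunctors of $\mathcal{C}$. The Cayley functor $\Upsilon_{\mathcal{C}}: \mathcal{C} \to \mathrm{Rex}(\mathcal{C})$, $X \mapsto (-) \otimes X$, has a left adjoint $\Upsilon_{\mathcal{C}}^*$.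 For a finite-dimensional vector space $V$ and $M \in \mathcal{C}$, the object $V \bullet M$ is defined by $\mathrm{Hom}_{\mathcal{C}}(V \bullet M, M') \cong \mathrm{Hom}_k(V, \mathrm{Hom}_{\mathcal{C}}(M, M'))$. Put $J_{\mathcal{C}} = \mathrm{Hom}_{\mathcal{C}}(-, \mathbf{1})^* \bullet \mathbf{1} \in \mathrm{Rex}(\mathcal{C})$, where $(-)^*$ on vector spaces is the linear dual. The modular object of $\mathcal{C}$ is $\alpha_{\mathcal{C}} := \Upsilon_{\mathcal{C}}^*[J_{\mathcal{C}}] \in \mathcal{C}$. Relative modular object: for $F$ as in the claim, the object $\chi_F$ of condition (3) is unique up to isomorphism and is called the relative modular object of $F$. *)

(* Defs.v *)
From HB Require Import structures.
From mathcomp Require Import all_boot all_order all_algebra.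
From mathcomp Require Import boolp.

Set Implicit Arguments.
Unset Strict Implicit.
Unset Printing Implicit Defensive.

Import GRing.Theory.
Local Open Scope ring_scope.

Reserved Notation "g \oc f" (at level 50, left associativity).
Reserved Notation "X \ot Y" (at level 40, left associativity).
Reserved Notation "f \otm g" (at level 40, left associativity).

Record category := Category {
  Ob :> Type;
  Hom : Ob -> Ob -> Type;
  idc : forall X, Hom X X;
  compc : forall X Y Z, Hom Y Z -> Hom X Y -> Hom X Z;
  compcA : forall W X Y Z (h : Hom Y Z) (g : Hom X Y) (f : Hom W X),
    compc h (compc g f) = compc (compc h g) f;
  comp1c : forall X Y (f : Hom X Y), compc (idc Y) f = f;
  compc1 : forall X Y (f : Hom X Y), compc f (idc X) = f
}.
Arguments Hom {c} X Y : rename.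
Arguments idc {c} X : rename.
Arguments compc {c X Y Z} g f : rename.
Notation "g \oc f" := (compc g f).

Definition inverse_pair (C : category) (X Y : C) (f : Hom X Y) (g : Hom Y X) :=
  g \oc f = idc X /\ f \oc g = idc Y.

Definition isomorphic (C : category) (X Y : C) :=
  exists (f : Hom X Y) (g : Hom Y X), inverse_pair f g.

Record functor (C D : category) := Functor {
  fobj :> C -> D;
  fmap : forall X Y, Hom X Y -> Hom (fobj X) (fobj Y);
  fmap1 : forall X, fmap (idc X) = idc (fobj X);
  fmapM : forall X Y Z (g : Hom Y Z) (f : Hom X Y),
    fmap (g \oc f) = fmap g \oc fmap f
}.
Arguments fmap {C D} f {X Y} u : rename.

Definition id_functor (C : category) : functor C C :=
  @Functor C C (fun X => X) (fun _ _ f => f)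
    (fun _ => erefl) (fun _ _ _ _ _ => erefl).

Program Definition comp_functor (C D E : category)
    (G : functor D E) (F : functor C D) : functor C E :=
  @Functor C E (fun X => G (F X)) (fun _ _ f => fmap G (fmap F f)) _ _.
Next Obligation. by rewrite !fmap1. Qed.
Next Obligation. by rewrite !fmapM. Qed.

Record nattrans (C D : category) (F G : functor C D) := NatTrans {
  ncomp :> forall X, Hom (F X) (G X);
  ncomp_nat : forall X Y (f : Hom X Y),
    ncomp Y \oc fmap F f = fmap G f \oc ncomp X
}.

Lemma nattransP (C D : category) (F G : functor C D) (a b : nattrans F G) :
  (forall X, a X = b X) -> a = b.
Proof.
case: a b => [a na] [b nb] /= eab.
have e : a = b by apply: functional_extensionality_dep.
by move: nb; rewrite -e => nb; congr NatTrans; apply: Prop_irrelevance.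
Qed.

Program Definition id_nattrans (C D : category) (F : functor C D) :
  nattrans F F := @NatTrans C D F F (fun X => idc (F X)) _.
Next Obligation. by rewrite comp1c compc1. Qed.

Program Definition comp_nattrans (C D : category) (F G H : functor C D)
    (b : nattrans G H) (a : nattrans F G) : nattrans F H :=
  @NatTrans C D F H (fun X => b X \oc a X) _.
Next Obligation. by rewrite -compcA ncomp_nat compcA ncomp_nat compcA. Qed.

Definition nat_isomorphic (C D : category) (F G : functor C D) :=
  exists (a : nattrans F G) (b : nattrans G F),
    forall X, inverse_pair (a X) (b X).

Definition is_equivalence (C D : category) (F : functor C D) :=
  exists G : functor D C,
    nat_isomorphic (comp_functor G F) (id_functor C) /\
    nat_isomorphic (comp_functor F G) (id_functor D).

(** [adjunction L R]: the functor [L] is left adjoint to [R]. *)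
Record adjunction (C D : category) (L : functor C D) (R : functor D C) :=
  Adjunction {
  adj_unit : nattrans (id_functor C) (comp_functor R L);
  adj_counit : nattrans (comp_functor L R) (id_functor D);
  adj_triL : forall X : C,
    adj_counit (L X) \oc fmap L (adj_unit X) = idc (L X);
  adj_triR : forall Y : D,
    fmap R (adj_counit Y) \oc adj_unit (R Y) = idc (R Y)
}.

Definition has_left_adjoint (C D : category) (F : functor C D) :=
  exists L : functor D C, inhabited (adjunction L F).

Definition has_right_adjoint (C D : category) (F : functor C D) :=
  exists R : functor D C, inhabited (adjunction F R).

(** The categories of interest are equivalent to categories of
    finite-dimensional modules, so that their Hom spaces are automatically
    finite-dimensional; this is why Hom spaces are taken in [vectType]. *)

Record linCat (k : fieldType) := LinCat {
  lob : Type;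
  lhom : lob -> lob -> vectType k;
  lid : forall X, lhom X X;
  lcomp : forall X Y Z, lhom Y Z -> lhom X Y -> lhom X Z;
  lcompA : forall W X Y Z (h : lhom Y Z) (g : lhom X Y) (f : lhom W X),
    lcomp h (lcomp g f) = lcomp (lcomp h g) f;
  lcomp1l : forall X Y (f : lhom X Y), lcomp (lid Y) f = f;
  lcomp1r : forall X Y (f : lhom X Y), lcomp f (lid X) = f;
  lcomp_linl : forall X Y Z (f : lhom X Y),
    linear (fun g : lhom Y Z => lcomp g f);
  lcomp_linr : forall X Y Z (g : lhom Y Z),
    linear (fun f : lhom X Y => lcomp g f)
}.

Definition cat_of_linCat (k : fieldType) (C : linCat k) : category :=
  @Category (lob C) (fun X Y => lhom X Y) (@lid k C) (@lcomp k C)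
    (@lcompA k C) (@lcomp1l k C) (@lcomp1r k C).
Coercion cat_of_linCat : linCat >-> category.
Arguments cat_of_linCat : simpl never.

Definition homV (k : fieldType) (C : linCat k) (X Y : C) : vectType k :=
  @lhom k C X Y.

Lemma lin0 (k : fieldType) (U V : lmodType k) (f : U -> V) :
  linear f -> f 0 = 0.
Proof. by move=> /(_ (-1) 0 0); rewrite !scaleN1r !addNr. Qed.

Section LinCat.
Variables (k : fieldType) (C : linCat k).
Implicit Types X Y Z : C.

Lemma comp_linl X Y Z (f : Hom X Y) :
  linear (fun g : Hom Y Z => g \oc f : Hom X Z).
Proof. exact: lcomp_linl. Qed.

Lemma comp_linr X Y Z (g : Hom Y Z) :
  linear (fun f : Hom X Y => g \oc f : Hom X Z).
Proof. exact: lcomp_linr. Qed.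

Definition precomp_fun X Y Z (f : Hom X Y) (g : Hom Y Z) : Hom X Z :=
  g \oc f.
HB.instance Definition _ X Y Z (f : Hom X Y) :=
  GRing.isLinear.Build k (homV Y Z) (homV X Z) _ (@precomp_fun X Y Z f)
    (comp_linl f).
Definition precomp X Y Z (f : Hom X Y) : 'Hom(homV Y Z, homV X Z) :=
  linfun (@precomp_fun X Y Z f).

Lemma precompE X Y Z (f : Hom X Y) (g : Hom Y Z) :
  precomp Z f g = g \oc f.
Proof. exact: lfunE. Qed.

Definition postcomp_fun X Y Z (g : Hom Y Z) (f : Hom X Y) : Hom X Z :=
  g \oc f.
HB.instance Definition _ X Y Z (g : Hom Y Z) :=
  GRing.isLinear.Build k (homV X Y) (homV X Z) _ (@postcomp_fun X Y Z g)
    (comp_linr g).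
Definition postcomp X Y Z (g : Hom Y Z) : 'Hom(homV X Y, homV X Z) :=
  linfun (@postcomp_fun X Y Z g).

Lemma postcompE X Y Z (g : Hom Y Z) (f : Hom X Y) :
  postcomp X g f = g \oc f.
Proof. exact: lfunE. Qed.

Lemma comp0c X Y Z (f : Hom X Y) : (0 : Hom Y Z) \oc f = 0 :> Hom X Z.
Proof. exact: (linear0 (@precomp_fun X Y Z f)). Qed.

Lemma compc0 X Y Z (g : Hom Y Z) : g \oc (0 : Hom X Y) = 0 :> Hom X Z.
Proof. exact: (linear0 (@postcomp_fun X Y Z g)). Qed.

Definition is_cokernel X Y Q (f : Hom X Y) (c : Hom Y Q) :=
  c \oc f = 0 :> Hom X Q /\
  forall Z (h : Hom Y Z), h \oc f = 0 :> Hom X Z ->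
    exists! u : Hom Q Z, u \oc c = h.

Definition is_kernel K X Y (i : Hom K X) (f : Hom X Y) :=
  f \oc i = 0 :> Hom K Y /\
  forall Z (h : Hom Z X), f \oc h = 0 :> Hom Z Y ->
    exists! u : Hom Z K, i \oc u = h.

End LinCat.

Section LinearFunctors.
Variables (k : fieldType) (C D : linCat k).

Definition linear_functor (F : functor C D) :=
  forall X Y : C, linear (fun f : Hom X Y => fmap F f : Hom (F X) (F Y)).

(** For linear functors between abelian categories, right (left) exactness
    is preservation of cokernels (kernels). *)
Definition right_exact (F : functor C D) :=
  forall (X Y Q : C) (f : Hom X Y) (c : Hom Y Q), is_cokernel f c ->
    is_cokernel (fmap F f : Hom (F X) (F Y)) (fmap F c : Hom (F Y) (F Q)).

Definition left_exact (F : functor C D) :=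
  forall (K X Y : C) (i : Hom K X) (f : Hom X Y), is_kernel i f ->
    is_kernel (fmap F i : Hom (F K) (F X)) (fmap F f : Hom (F X) (F Y)).

Definition exact_functor (F : functor C D) := left_exact F /\ right_exact F.

End LinearFunctors.

(** MathComp's [falgType] excludes the zero algebra, whence this record. *)

Record fdAlgebra (k : fieldType) := FdAlgebra {
  acar :> vectType k;
  amul : acar -> acar -> acar;
  aone : acar;
  amulA : associative amul;
  amul1l : left_id aone amul;
  amul1r : right_id aone amul;
  amul_linl : forall b, linear (amul^~ b);
  amul_linr : forall a, linear (amul a)
}.

Record rightModule (k : fieldType) (A : fdAlgebra k) := RightModule {
  mcar :> vectType k;
  ract : mcar -> A -> mcar;
  ractM : forall m a b, ract m (amul a b) = ract (ract m a) b;
  ract1 : forall m, ract m (aone A) = m;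
  ract_linl : forall a, linear (ract^~ a);
  ract_linr : forall m, linear (ract m)
}.

Section Modules.
Variables (k : fieldType) (A : fdAlgebra k).
Implicit Types M N P : rightModule A.

Definition ract_by M (a : A) (m : M) : M := ract m a.
HB.instance Definition _ M a :=
  GRing.isLinear.Build k M M _ (@ract_by M a) (@ract_linl k A M a).

Definition equiv_defect M N (a : A) (f : 'Hom(M, N)) : 'Hom(M, N) :=
  ((f \o linfun (@ract_by M a)) - (linfun (@ract_by N a) \o f))%VF.

Lemma equiv_defect_linear M N a : linear (@equiv_defect M N a).
Proof.
move=> c f g; apply/lfunP => m; rewrite /equiv_defect.
rewrite !(add_lfunE, opp_lfunE, scale_lfunE) !comp_lfunE !lfunE /=.
rewrite !(add_lfunE, scale_lfunE) /= /ract_by ract_linl.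
by rewrite scalerBr opprD addrACA.
Qed.
HB.instance Definition _ M N a :=
  GRing.isLinear.Build k 'Hom(M, N) 'Hom(M, N) _ (@equiv_defect M N a)
    (@equiv_defect_linear M N a).

(** The space of module homomorphisms; see [modHomP]. *)
Definition modHom M N : {vspace 'Hom(M, N)} :=
  (\bigcap_(i < \dim {:A}) lker (linfun (@equiv_defect M N (vbasis {:A})`_i)))%VS.

Lemma modHomP M N (f : 'Hom(M, N)) :
  f \in modHom M N <-> forall m a, f (ract m a) = ract (f m) a.
Proof.
split=> [fM m a|fM]; last first.
  rewrite memvE; apply/subv_bigcapP => i _; rewrite -memvE memv_ker lfunE /=.
  apply/eqP/lfunP => m.
  by rewrite add_lfunE opp_lfunE !comp_lfunE !lfunE /= /ract_by fM subrr.
have fi (i : 'I_(\dim {:A})) :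
    f (ract m (vbasis {:A})`_i) = ract (f m) (vbasis {:A})`_i.
  move: fM; rewrite memvE => /subv_bigcapP/(_ i isT).
  rewrite -memvE memv_ker lfunE => /eqP/lfunP/(_ m) /eqP.
  by rewrite add_lfunE opp_lfunE !comp_lfunE !lfunE /= /ract_by subr_eq0 => /eqP.
have lin1 : linear (fun a => f (ract m a)).
  by move=> c x y; rewrite ract_linr linearP.
pose F1 := GRing.isLinear.Build k A N _ (fun a => f (ract m a)) lin1.
pose g1 : {linear A -> N} := HB.pack (fun a => f (ract m a)) F1.
pose F2 := GRing.isLinear.Build k A N _ (ract (f m)) (@ract_linr k A N (f m)).
pose g2 : {linear A -> N} := HB.pack (ract (f m)) F2.
rewrite -[LHS]/(g1 a) -[RHS]/(g2 a) (coord_vbasis (memvf a)) !linear_sum /=.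
by apply: eq_bigr => i _; rewrite -[LHS]/(g1 _) -[RHS]/(g2 _) !linearZ /= fi.
Qed.

Definition modHomT M N : vectType k := subvs_of (modHom M N).

Lemma modHom_id M : (\1%VF : 'Hom(M, M)) \in modHom M M.
Proof. by apply/modHomP => m a; rewrite !id_lfunE. Qed.

Lemma modHom_comp M N P (g : modHomT N P) (f : modHomT M N) :
  (vsval g \o vsval f)%VF \in modHom M P.
Proof.
by apply/modHomP => m a; rewrite !comp_lfunE !(modHomP _).1 ?subvsP.
Qed.

Definition mod_id M : modHomT M M := Subvs (modHom_id M).
Definition mod_comp M N P (g : modHomT N P) (f : modHomT M N) : modHomT M P :=
  Subvs (modHom_comp g f).

Program Definition modCat : linCat k :=
  @LinCat k (rightModule A) modHomT mod_id mod_comp _ _ _ _ _.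
Next Obligation. by apply: subvs_inj; rewrite /= comp_lfunA. Qed.
Next Obligation. by apply: subvs_inj; rewrite /= comp_lfun1l. Qed.
Next Obligation. by apply: subvs_inj; rewrite /= comp_lfun1r. Qed.
Next Obligation.
move=> c u v; apply: subvs_inj.
by rewrite /= comp_lfunDl comp_lfunZl.
Qed.
Next Obligation.
move=> c u v; apply: subvs_inj.
by rewrite /= comp_lfunDr comp_lfunZr.
Qed.

End Modules.

(** Being linearly equivalent to some mod-A, a finite category is abelian. *)
Definition finite_category (k : fieldType) (C : linCat k) :=
  exists (A : fdAlgebra k) (F : functor C (modCat A)),
    linear_functor F /\ is_equivalence F.

Record monoidalLinCat (k : fieldType) := MonoidalLinCat {
  mon_cat :> linCat k;
  tobj : mon_cat -> mon_cat -> mon_cat;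
  tmor : forall X X' Y Y' : mon_cat,
    Hom X X' -> Hom Y Y' -> Hom (tobj X Y) (tobj X' Y');
  tunit : mon_cat;
  tass : forall X Y Z, Hom (tobj (tobj X Y) Z) (tobj X (tobj Y Z));
  tassV : forall X Y Z, Hom (tobj X (tobj Y Z)) (tobj (tobj X Y) Z);
  tlun : forall X, Hom (tobj tunit X) X;
  tlunV : forall X, Hom X (tobj tunit X);
  trun : forall X, Hom (tobj X tunit) X;
  trunV : forall X, Hom X (tobj X tunit);
  tmor1 : forall X Y, tmor (idc X) (idc Y) = idc (tobj X Y);
  tmorM : forall X X' X'' Y Y' Y''
      (f' : Hom X' X'') (f : Hom X X') (g' : Hom Y' Y'') (g : Hom Y Y'),
    tmor (f' \oc f) (g' \oc g) = tmor f' g' \oc tmor f g;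
  tmor_linl : forall X X' Y Y' (g : Hom Y Y'),
    linear (fun f : homV X X' => tmor f g : homV (tobj X Y) (tobj X' Y'));
  tmor_linr : forall X X' Y Y' (f : Hom X X'),
    linear (fun g : homV Y Y' => tmor f g : homV (tobj X Y) (tobj X' Y'));
  tassK : forall X Y Z, inverse_pair (tass X Y Z) (tassV X Y Z);
  tlunK : forall X, inverse_pair (tlun X) (tlunV X);
  trunK : forall X, inverse_pair (trun X) (trunV X);
  tass_nat : forall X X' Y Y' Z Z'
      (f : Hom X X') (g : Hom Y Y') (h : Hom Z Z'),
    tass X' Y' Z' \oc tmor (tmor f g) h = tmor f (tmor g h) \oc tass X Y Z;
  tlun_nat : forall X X' (f : Hom X X'),
    tlun X' \oc tmor (idc tunit) f = f \oc tlun X;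
  trun_nat : forall X X' (f : Hom X X'),
    trun X' \oc tmor f (idc tunit) = f \oc trun X;
  pentagon : forall W X Y Z,
    tass W X (tobj Y Z) \oc tass (tobj W X) Y Z =
    tmor (idc W) (tass X Y Z) \oc tass W (tobj X Y) Z
      \oc tmor (tass W X Y) (idc Z);
  triangle : forall X Y,
    tmor (idc X) (tlun Y) \oc tass X tunit Y = tmor (trun X) (idc Y)
}.
Arguments tunit {k m} : rename.
Arguments tmor {k m X X' Y Y'} f g : rename.
Arguments tass {k m} X Y Z : rename.
Arguments tassV {k m} X Y Z : rename.
Arguments tlun {k m} X : rename.
Arguments tlunV {k m} X : rename.
Arguments trun {k m} X : rename.
Arguments trunV {k m} X : rename.
Notation "X \ot Y" := (tobj X Y).
Notation "f \otm g" := (tmor f g).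

(** [dual_pair ev coev] for [ev : Y \ot X -> 1], [coev : 1 -> X \ot Y]:
    [Y] is a left dual of [X] (and [X] is a right dual of [Y]). *)
Definition dual_pair (k : fieldType) (C : monoidalLinCat k) (X Y : C)
    (ev : Hom (Y \ot X) tunit) (coev : Hom tunit (X \ot Y)) :=
  trun X \oc (idc X \otm ev) \oc tass X Y X \oc (coev \otm idc X) \oc tlunV X
    = idc X /\
  tlun Y \oc (ev \otm idc Y) \oc tassV Y X Y \oc (idc Y \otm coev) \oc trunV Y
    = idc Y.

Record finTensCat (k : fieldType) := FinTensCat {
  ftc_mon :> monoidalLinCat k;
  ldual : ftc_mon -> ftc_mon;
  ldual_ev : forall X, Hom (ldual X \ot X) tunit;
  ldual_coev : forall X, Hom tunit (X \ot ldual X);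
  ldualP : forall X, dual_pair (ldual_ev X) (ldual_coev X);
  rdual : ftc_mon -> ftc_mon;
  rdual_ev : forall X, Hom (X \ot rdual X) tunit;
  rdual_coev : forall X, Hom tunit (rdual X \ot X);
  rdualP : forall X, dual_pair (rdual_ev X) (rdual_coev X);
  ftc_finite : finite_category ftc_mon
}.

Record tensorFunctor (k : fieldType) (C D : monoidalLinCat k) :=
  TensorFunctor {
  tf_fun :> functor C D;
  tf_lin : linear_functor tf_fun;
  tf_unit : Hom tunit (tf_fun tunit);
  tf_unitV : Hom (tf_fun tunit) tunit;
  tf_mul : forall X Y, Hom (tf_fun X \ot tf_fun Y) (tf_fun (X \ot Y));
  tf_mulV : forall X Y, Hom (tf_fun (X \ot Y)) (tf_fun X \ot tf_fun Y);
  tf_unitK : inverse_pair tf_unit tf_unitV;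
  tf_mulK : forall X Y, inverse_pair (tf_mul X Y) (tf_mulV X Y);
  tf_mul_nat : forall X X' Y Y' (f : Hom X X') (g : Hom Y Y'),
    tf_mul X' Y' \oc (fmap tf_fun f \otm fmap tf_fun g) =
    fmap tf_fun (f \otm g) \oc tf_mul X Y;
  tf_ass : forall X Y Z,
    fmap tf_fun (tass X Y Z) \oc tf_mul (X \ot Y) Z
      \oc (tf_mul X Y \otm idc (tf_fun Z)) =
    tf_mul X (Y \ot Z) \oc (idc (tf_fun X) \otm tf_mul Y Z)
      \oc tass (tf_fun X) (tf_fun Y) (tf_fun Z);
  tf_lun : forall X,
    fmap tf_fun (tlun X) \oc tf_mul tunit X \oc (tf_unit \otm idc (tf_fun X))
      = tlun (tf_fun X);
  tf_run : forall X,
    fmap tf_fun (trun X) \oc tf_mul X tunit \oc (idc (tf_fun X) \otm tf_unit)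
      = trun (tf_fun X)
}.

Record rexFunctor (k : fieldType) (C : linCat k) := RexFunctor {
  rex_fun :> functor C C;
  rex_lin : linear_functor rex_fun;
  rex_exact : right_exact rex_fun
}.

Program Definition Rex (k : fieldType) (C : linCat k) : category :=
  @Category (rexFunctor C) (fun F G => nattrans F G)
    (fun F => id_nattrans F) (fun F G H b a => comp_nattrans b a) _ _ _.
Next Obligation. by apply: nattransP => ?; apply: compcA. Qed.
Next Obligation. by apply: nattransP => ?; apply: comp1c. Qed.
Next Obligation. by apply: nattransP => ?; apply: compc1. Qed.

Section TensorRight.
Variables (k : fieldType) (C : monoidalLinCat k).
Implicit Types X Y Z : C.

Lemma tmorMl X X' X'' Y (f' : Hom X' X'') (f : Hom X X') :
  (f' \otm idc Y) \oc (f \otm idc Y) = (f' \oc f) \otm idc Y.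
Proof. by rewrite -tmorM comp1c. Qed.

Lemma tmorMr X Y Y' Y'' (f' : Hom Y' Y'') (f : Hom Y Y') :
  (idc X \otm f') \oc (idc X \otm f) = idc X \otm (f' \oc f).
Proof. by rewrite -tmorM comp1c. Qed.

Lemma tmor_swap X X' Y Y' (f : Hom X X') (g : Hom Y Y') :
  (idc X' \otm g) \oc (f \otm idc Y) = (f \otm idc Y') \oc (idc X \otm g).
Proof. by rewrite -!tmorM !comp1c !compc1. Qed.

Lemma trun_faithful X Y (f g : Hom X Y) :
  f \otm idc tunit = g \otm idc tunit -> f = g.
Proof.
move=> e; have := congr1 (fun u => trun Y \oc u \oc trunV X) e.
by rewrite !trun_nat -!compcA (trunK X).2 !compc1.
Qed.

Lemma trun_tensor X Y :
  trun (X \ot Y) = (idc X \otm trun Y) \oc tass X Y tunit.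
Proof.
apply: trun_faithful; rewrite -triangle.
have tK W (u v : Hom W _) : tass X Y tunit \oc u = tass X Y tunit \oc v -> u = v.
  move=> e; have := congr1 (fun w => tassV X Y tunit \oc w) e.
  by rewrite !compcA (tassK _ _ _).1 !comp1c.
apply: tK; rewrite -tmor1 compcA tass_nat -compcA pentagon !compcA.
by rewrite tmorMr triangle -tass_nat -!compcA tmorMl.
Qed.

(** [- \ot X] is linear and, because [X] has a left dual, right exact. *)
Definition tensr_fmap X Y Y' (f : Hom Y Y') : Hom (Y \ot X) (Y' \ot X) :=
  f \otm idc X.

Lemma tensr1 X Y : tensr_fmap X (idc Y) = idc (Y \ot X).
Proof. exact: tmor1. Qed.

Lemma tensrM X Y Y' Y'' (g : Hom Y' Y'') (f : Hom Y Y') :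
  tensr_fmap X (g \oc f) = tensr_fmap X g \oc tensr_fmap X f.
Proof. by rewrite /tensr_fmap tmorMl. Qed.

Definition tensr X : functor C C :=
  @Functor C C (fun Y => Y \ot X) (tensr_fmap X) (tensr1 X) (tensrM X).

Lemma tensr_linear X : linear_functor (tensr X).
Proof. by move=> Y Y'; apply: tmor_linl. Qed.

Lemma tensr_right_exact X X' (ev : Hom (X' \ot X) tunit)
    (coev : Hom tunit (X \ot X')) :
  dual_pair ev coev -> right_exact (tensr X).
Proof.
move=> [zig _] A B Q f c [cf0 cU].
pose fl Y Z (h : Hom (Y \ot X) Z) : Hom Y (Z \ot X') :=
  (h \otm idc X') \oc (tassV Y X X' \oc (idc Y \otm coev) \oc trunV Y).
pose sh Y Z (u : Hom Y (Z \ot X')) : Hom (Y \ot X) Z :=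
  trun Z \oc (idc Z \otm ev) \oc tass Z X' X \oc (u \otm idc X).
have flM Y Y' Z (h : Hom (Y' \ot X) Z) (g : Hom Y Y') :
    fl _ _ (h \oc (g \otm idc X)) = fl _ _ h \oc g.
  have tVn : tassV Y' X X' \oc (g \otm idc (X \ot X')) =
      ((g \otm idc X) \otm idc X') \oc tassV Y X X'.
    rewrite -tmor1 -[LHS]compc1 -(tassK Y X X').2 compcA.
    rewrite -[_ \oc (g \otm _) \oc _]compcA -tass_nat !compcA.
    by rewrite (tassK _ _ _).1 comp1c.
  have trVn : (g \otm idc tunit) \oc trunV Y = trunV Y' \oc g.
    rewrite -[LHS]comp1c -(trunK Y').1 -!compcA; congr (_ \oc _).
    by rewrite compcA trun_nat -compcA (trunK Y).2 compc1.
  rewrite /fl -tmorMl -!compcA -trVn; congr (_ \oc _).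
  rewrite [in RHS]compcA [in RHS]compcA -[_ \oc (g \otm _)]compcA.
  by rewrite tmor_swap !compcA tVn.
have shM Y Y' Z (u : Hom Y' (Z \ot X')) (g : Hom Y Y') :
    sh _ _ (u \oc g) = sh _ _ u \oc (g \otm idc X).
  by rewrite /sh -tmorMl !compcA.
have flK Y Z (h : Hom (Y \ot X) Z) : sh _ _ (fl _ _ h) = h.
  rewrite /fl shM /sh -[_ \oc ((h \otm _) \otm _)]compcA tass_nat tmor1.
  rewrite !compcA -[_ \oc (h \otm idc (X' \ot X))]compcA tmor_swap.
  rewrite !compcA trun_nat -!compcA -[RHS]compc1; congr (_ \oc _).
  rewrite trun_tensor -!tmorMl.
  have aV : tass (Y \ot X) X' X \oc (tassV Y X X' \otm idc X) =
      tassV Y X (X' \ot X) \oc (idc Y \otm tass X X' X)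
        \oc tass Y (X \ot X') X.
    rewrite -[LHS]comp1c -(tassK Y X (X' \ot X)).1 -!compcA; congr (_ \oc _).
    rewrite compcA pentagon -!compcA tmorMl (tassK _ _ _).2 tmor1.
    by rewrite compc1.
  have evV : (idc (Y \ot X) \otm ev) \oc tassV Y X (X' \ot X) =
      tassV Y X tunit \oc (idc Y \otm (idc X \otm ev)).
    rewrite -[LHS]comp1c -(tassK Y X tunit).1 -!compcA; congr (_ \oc _).
    by rewrite compcA -tmor1 tass_nat -compcA (tassK _ _ _).2 compc1.
  have trV : tass Y tunit X \oc (trunV Y \otm idc X) = idc Y \otm tlunV X.
    rewrite -[LHS]comp1c -tmor1 -(tlunK X).1 -tmorMr -!compcA.
    rewrite [_ \oc (tass _ _ _ \oc _)]compcA triangle tmorMl.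
    by rewrite (trunK _).2 tmor1 compc1.
  rewrite [tass (Y \ot X) X' X \oc _]compcA aV -!compcA.
  rewrite [tass Y (X \ot X') X \oc _]compcA tass_nat -!compcA trV.
  rewrite [(idc (Y \ot X) \otm ev) \oc _]compcA evV -!compcA.
  rewrite [tass Y X tunit \oc _]compcA (tassK _ _ _).2 comp1c.
  by rewrite !tmorMr !compcA zig tmor1.
split=> [|Z h /= hf0].
  rewrite -fmapM cf0.
  exact: (lin0 (@tensr_linear X A Q)).
have [|u [uc uu]] := cU _ (fl _ _ h).
  rewrite -flM (hf0 : h \oc (f \otm idc X) = 0) /fl.
  by rewrite (lin0 (@tmor_linl _ _ _ _ _ _ (idc X'))); apply: comp0c.
exists (sh _ _ u); split; first by rewrite -[LHS](shM _ _ _ u c) uc flK.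
move=> v vc.
rewrite -(flK _ _ v); congr (sh _ _ _); apply: uu.
by rewrite -flM; congr (fl _ _ _).
Qed.

End TensorRight.

(** The Cayley functor X |-> - \ot X. *)
Section Cayley.
Variables (k : fieldType) (C : finTensCat k).

Definition cayley_obj (X : C) : Rex C :=
  RexFunctor (@tensr_linear k C X) (tensr_right_exact (ldualP X)).

Definition cayley_comp (X X' : C) (f : Hom X X') (Y : C) :
  Hom (cayley_obj X Y) (cayley_obj X' Y) := idc Y \otm f.

Lemma cayley_nat (X X' : C) (f : Hom X X') (Y Y' : C) (g : Hom Y Y') :
  cayley_comp f Y' \oc fmap (cayley_obj X) g =
  fmap (cayley_obj X') g \oc cayley_comp f Y.
Proof. exact: tmor_swap. Qed.

Definition cayley_mor (X X' : C) (f : Hom X X') :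
  Hom (cayley_obj X) (cayley_obj X') := NatTrans (cayley_nat f).

Lemma cayley_mor1 (X : C) : cayley_mor (idc X) = idc (cayley_obj X).
Proof. by apply: nattransP => Y; apply: tmor1. Qed.

Lemma cayley_morM (X X' X'' : C) (g : Hom X' X'') (f : Hom X X') :
  cayley_mor (g \oc f) = cayley_mor g \oc cayley_mor f.
Proof. by apply: nattransP => Y; symmetry; apply: tmorMr. Qed.

Definition cayley : functor C (Rex C) :=
  @Functor C (Rex C) cayley_obj cayley_mor cayley_mor1 cayley_morM.

End Cayley.

Definition linear_dual (k : fieldType) (V : vectType k) : vectType k :=
  'Hom(V, k^o).

(** [copw V M] is V \bullet M; [copw_to] is the bijection
    Hom(V \bullet M, M') -> Hom_k(V, Hom(M, M')). It is natural in M', hence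
    automatically k-linear. *)
Record copowers (k : fieldType) (C : linCat k) := Copowers {
  copw :> vectType k -> C -> C;
  copw_to : forall (V : vectType k) (M M' : C), Hom (copw V M) M' -> 'Hom(V, homV M M');
  copw_from : forall (V : vectType k) (M M' : C), 'Hom(V, homV M M') -> Hom (copw V M) M';
  copw_toK : forall (V : vectType k) (M M' : C), cancel (@copw_to V M M') (@copw_from V M M');
  copw_fromK : forall (V : vectType k) (M M' : C),
    cancel (@copw_from V M M') (@copw_to V M M');
  copw_nat : forall (V : vectType k) (M M' M'' : C) (g : Hom M' M'') (f : Hom (copw V M) M'),
    copw_to (g \oc f) = (postcomp M g \o copw_to f)%VF
}.
Arguments copw_to {k C} c {V M M'} f : rename.
Arguments copw_from {k C} c {V M M'} u : rename.

Section CopowerMaps.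
Variables (k : fieldType) (C : linCat k) (P : copowers C).

Definition copw_map (V W : vectType k) (M : C) (u : 'Hom(V, W)) :
    Hom (P V M) (P W M) :=
  copw_from P (copw_to P (idc (P W M)) \o u)%VF.

Lemma copw_inj (V : vectType k) (M M' : C) (f g : Hom (P V M) M') :
  copw_to P f = copw_to P g -> f = g.
Proof. by move=> e; rewrite -(copw_toK f) e copw_toK. Qed.

Lemma copw_toE (V : vectType k) (M M' : C) (f : Hom (P V M) M') :
  copw_to P f = (postcomp M f \o copw_to P (idc (P V M)))%VF.
Proof. by rewrite -copw_nat compc1. Qed.

Lemma copw_to_map (V W : vectType k) (M M' : C)
    (u : 'Hom(V, W)) (f : Hom (P W M) M') :
  copw_to P (f \oc copw_map M u) = (copw_to P f \o u)%VF.
Proof.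
by rewrite copw_nat /copw_map copw_fromK comp_lfunA -copw_toE.
Qed.

Lemma copw_map1 (V : vectType k) (M : C) : copw_map M \1%VF = idc (P V M).
Proof.
by apply: copw_inj; rewrite -[copw_map _ _]comp1c copw_to_map comp_lfun1r.
Qed.

Lemma copw_mapM (U V W : vectType k) (M : C)
    (v : 'Hom(V, W)) (u : 'Hom(U, V)) :
  copw_map M (v \o u)%VF = copw_map M v \oc copw_map M u.
Proof.
apply: copw_inj; rewrite -[copw_map _ (v \o u)%VF]comp1c.
rewrite -[copw_map _ v]comp1c.
by rewrite !copw_to_map comp_lfunA.
Qed.

Lemma copw_to_linear (V : vectType k) (M M' : C) :
  linear (fun f : homV (P V M) M' => copw_to P f).
Proof.
move=> a f g; apply/lfunP => x.
rewrite add_lfunE scale_lfunE (copw_toE (a *: f + g)) (copw_toE f) (copw_toE g).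
rewrite !comp_lfunE !postcompE.
exact: comp_linl.
Qed.

Lemma copw_map_linear (V W : vectType k) (M : C) :
  linear (fun u : 'Hom(V, W) => copw_map M u : homV (P V M) (P W M)).
Proof.
move=> a u v; apply: copw_inj; rewrite copw_to_linear /=.
by rewrite /copw_map !copw_fromK comp_lfunDr comp_lfunZr.
Qed.

End CopowerMaps.

Section Dual.
Variables (k : fieldType) (U V W : vectType k).

Definition dual_map_fun (u : 'Hom(U, V)) (phi : linear_dual V) :
  linear_dual U := (phi \o u)%VF.
Lemma dual_map_fun_linear u : linear (dual_map_fun u).
Proof. by move=> a f g; rewrite /dual_map_fun comp_lfunDl comp_lfunZl. Qed.
HB.instance Definition _ u :=
  GRing.isLinear.Build k (linear_dual V) (linear_dual U) _ (dual_map_fun u)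
    (dual_map_fun_linear u).

Definition dual_map (u : 'Hom(U, V)) : 'Hom(linear_dual V, linear_dual U) :=
  linfun (dual_map_fun u).

Lemma dual_mapE u phi : dual_map u phi = (phi \o u)%VF.
Proof. exact: lfunE. Qed.

Lemma dual_map_linear : linear dual_map.
Proof.
move=> a u v; apply/lfunP => phi.
by rewrite add_lfunE scale_lfunE !dual_mapE comp_lfunDr comp_lfunZr.
Qed.

End Dual.

Lemma dual_exact (k : fieldType) (U V W T : vectType k)
    (a : 'Hom(U, V)) (b : 'Hom(V, W)) (h : 'Hom(linear_dual V, T)) :
  injective a -> (b \o a = 0)%VF -> (forall v, b v = 0 -> exists u, a u = v) ->
  (h \o dual_map b = 0)%VF -> exists! g, (g \o dual_map a)%VF = h.
Proof.
move=> /lker0P a0 ba0 kerb hb0.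
have aV : (a^-1 \o a = \1)%VF by apply: lker0_compVf.
have sK : (dual_map a \o dual_map a^-1 = \1)%VF.
  apply/lfunP => phi; rewrite comp_lfunE !dual_mapE id_lfunE.
  by rewrite -comp_lfunA aV comp_lfun1r.
exists (h \o dual_map a^-1)%VF; split=> [|g <-]; last first.
  by rewrite -comp_lfunA sK comp_lfun1r.
apply/lfunP => phi; rewrite !comp_lfunE !dual_mapE.
apply/eqP; rewrite -subr_eq0 -linearB /=; apply/eqP.
set psi : linear_dual V := _ - _.
have psib v : b v = 0 -> psi v = 0.
  move=> /kerb[u <-]; rewrite add_lfunE opp_lfunE !comp_lfunE.
  by rewrite -(comp_lfunE a^-1%VF a) aV id_lfunE subrr.
have -> : psi = dual_map b (psi \o b^-1)%VF.
  rewrite dual_mapE; apply/lfunP => v; rewrite !comp_lfunE.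
  apply/eqP; rewrite -subr_eq0 -linearB /=; apply/eqP/psib.
  rewrite linearB /=; apply/eqP; rewrite subr_eq0; apply/eqP.
  by rewrite -[in LHS](inv_lfun_def b) !comp_lfunE.
by rewrite -comp_lfunE hb0 zero_lfunE.
Qed.

(** The functor J = Hom(-, 1)^* \bullet 1. *)
Section JFunctor.
Variables (k : fieldType) (C : monoidalLinCat k) (P : copowers C).

Definition J_obj (X : C) : C := P (linear_dual (homV X tunit)) tunit.

Definition J_fmap (X Y : C) (f : Hom X Y) : Hom (J_obj X) (J_obj Y) :=
  copw_map P tunit (dual_map (precomp tunit f)).

Lemma J_fmap1 (X : C) : J_fmap (idc X) = idc (J_obj X).
Proof.
rewrite /J_fmap -copw_map1; congr copw_map; apply/lfunP => phi.
rewrite dual_mapE id_lfunE; apply/lfunP => x.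
by rewrite comp_lfunE precompE compc1.
Qed.

Lemma J_fmapM (X Y Z : C) (g : Hom Y Z) (f : Hom X Y) :
  J_fmap (g \oc f) = J_fmap g \oc J_fmap f.
Proof.
rewrite /J_fmap -copw_mapM; congr copw_map; apply/lfunP => phi.
rewrite comp_lfunE !dual_mapE; apply/lfunP => x.
by rewrite !comp_lfunE !precompE compcA.
Qed.

Definition J_fun : functor C C := Functor J_fmap1 J_fmapM.

Lemma J_linear : linear_functor J_fun.
Proof.
move=> X Y a f g; rewrite /= /J_fmap.
rewrite -copw_map_linear -dual_map_linear; congr copw_map; congr dual_map.
apply/lfunP => x; rewrite add_lfunE scale_lfunE !precompE.
exact: comp_linr.
Qed.

Lemma J_right_exact : right_exact J_fun.
Proof.
move=> X Y Q f c [cf0 cU]; split.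
  by rewrite -fmapM cf0; apply: (lin0 (@J_linear X Q)).
move=> Z h hf0.
have := @dual_exact k _ _ _ _ (precomp tunit c) (precomp tunit f)
  (copw_to P h).
case.
- move=> x y; rewrite !precompE => exy.
  have [|u [_ uu]] := cU tunit (@compc C _ _ _ x c).
    by rewrite -compcA cf0 compc0.
  by rewrite -(uu x) // -(uu y).
- apply/lfunP => x; rewrite comp_lfunE !precompE -compcA cf0 zero_lfunE.
  exact: compc0.
- move=> v; rewrite precompE => vf0; have [u [uc _]] := cU _ v vf0.
  by exists u; rewrite precompE.
- by rewrite -copw_to_map [_ \oc _]hf0; apply: (lin0 (@copw_to_linear _ _ P _ _ _)).
move=> g [gc gu]; exists (copw_from P g); split.
  by apply: (@copw_inj _ _ P); rewrite copw_to_map copw_fromK.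
move=> v vc; rewrite -(copw_toK v); congr (copw_from P _); apply: gu.
by rewrite -copw_to_map; congr (copw_to P _).
Qed.

Definition J_rex : Rex C := RexFunctor J_linear J_right_exact.

End JFunctor.

(** [UpsL] stands for a left adjoint of the Cayley functor. *)
Definition modular_object (k : fieldType) (C : finTensCat k) (P : copowers C)
    (UpsL : functor (Rex C) C) : C := UpsL (J_rex P).

(** [chi] is a relative modular object of the functor with left adjoint [L]
    and right adjoint [R]. *)
Definition is_relative_modular_object (k : fieldType) (C D : finTensCat k)
    (L R : functor D C) (chi : D) :=
  nat_isomorphic R (comp_functor L (tensr chi)).

(* Main.v *)
From HB Require Import structures.
From Corelib Require Import Setoid Morphisms.
From mathcomp Require Import all_boot all_order all_algebra.
From mathcomp Require Import boolp.
Require Import Defs.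

(** The modular object of a finite tensor category is the value of the right
    exact Nakayama functor at the unit object, and the whole argument takes
    place on projective objects, where the Nakayama functor N is described by
    linear duality alone: a perfect pairing
      Hom(Z, I) x Hom(I, X) -> k,   natural in the projective object I,
    exhibits X as N(Z).  The predicate [nakayama Z X] records such a pairing.
    By a Yoneda argument over projectives it determines X from Z
    ([nakayama_unique]), and it is transported by any functor that preserves
    projectives and has suitable adjoints ([nakayama_transport]).

    The modular object satisfies [nakayama 1 alpha]
    ([nakayama_modular_object]).  A transformation from Hom(-, 1)^* \bullet 1
    to - \ot Y is a natural family of maps Hom(M, 1)^* -> Hom(1, M \ot Y).
    Such families are detected on the single projective generator P, where
    Hom(1, P \ot alpha) is dual to Hom(P, 1); this makes alpha the universal
    target.

    Tensoring and dualizing the pairing of alpha gives, for every Z,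
      [nakayama ^*Z (alpha \ot Z^* )]   and   [nakayama ^*alpha 1].
    With Z = alpha both are values at ^*alpha, so alpha \ot alpha^* is
    isomorphic to 1; the same statement for the reversed tensor product shows
    that alpha is invertible ([nakayama_unit_invertible]).  With Z invertible,
    comparison with the reversed tensor product shows that alpha commutes with
    every invertible object ([nakayama_unit_central]).

    Finally, for I projective in D, the isomorphism R(I) = L(I \ot chi) gives
      Hom(I, F(alpha_C) \ot chi^* ) = Hom(L(I \ot chi), alpha_C)
        = Hom(1, L(I \ot chi))^* = Hom(1, R(I))^* = Hom(1, I)^*,
    so F(alpha_C) \ot chi^* has the property that characterizes alpha_D
    ([nakayama_relative]).  Since F(alpha_C) and alpha_D are invertible, this
    equation can be solved for chi, and since they commute the two factors can
    be written in either order. *)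

Set Implicit Arguments.
Unset Strict Implicit.
Unset Printing Implicit Defensive.

Import GRing.Theory.
Local Open Scope ring_scope.

(** * Perfect pairings *)

Section LinearAlgebra.
Variable k : fieldType.
Implicit Types U V W : vectType k.

Definition lfun_of U V (f : U -> V) (f_lin : linear f) : 'Hom(U, V) :=
  linfun (HB.pack f (GRing.isLinear.Build k U V _ f f_lin) : {linear U -> V}).

Lemma lfun_ofE U V (f : U -> V) (f_lin : linear f) u : lfun_of f_lin u = f u.
Proof. exact: lfunE. Qed.

Lemma linear_can U V (f : U -> V) (g : V -> U) :
  linear f -> cancel f g -> cancel g f -> linear g.
Proof. by move=> fl fK gK a u v; rewrite -{1}(gK u) -{1}(gK v) -fl fK. Qed.

(** Otherwise the projection along S onto a complement moves v to a nonzero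
    vector, one of whose coordinates is a functional killing S but not v. *)
Lemma mem_of_functionals V (S : {vspace V}) (v : V) :
  (forall psi : 'Hom(V, k^o), (forall s, s \in S -> psi s = 0) -> psi v = 0) ->
  v \in S.
Proof.
move=> kill; pose p : 'Hom(V, V) := (\1 - projv S)%VF.
have pS s : s \in S -> p s = 0.
  by move=> Ss; rewrite add_lfunE opp_lfunE id_lfunE projv_id ?subrr.
have p0 : p v = 0.
  rewrite (coord_vbasis (memvf (p v))) big1 // => i _.
  pose psi : 'Hom(V, k^o) := (linfun (coord (vbasis fullv) i : V -> k^o) \o p)%VF.
  have := kill psi; rewrite comp_lfunE lfunE /= => ->; first by rewrite scale0r.
  by move=> s Ss; rewrite comp_lfunE pS // linear0.
move/eqP: p0; rewrite add_lfunE opp_lfunE id_lfunE subr_eq0 => /eqP->.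
exact: memv_proj.
Qed.

Lemma functionals_separate V (v : V) :
  (forall psi : 'Hom(V, k^o), psi v = 0) -> v = 0.
Proof.
move=> kill; apply/eqP; rewrite -memv0.
by apply: mem_of_functionals => psi _; apply: kill.
Qed.

Lemma form_sum U (psi : U -> k) n (f : 'I_n -> U) :
  linear (psi : U -> k^o) -> psi (\sum_i f i) = \sum_i psi (f i).
Proof.
move=> psil; rewrite -(lfun_ofE psil) linear_sum.
by apply: eq_bigr => i _; apply: (lfun_ofE psil).
Qed.

(** Nondegeneracy is asked on both sides, so that the notion is visibly
    symmetric; finite dimension turns it into duality ([perfect_repr]). *)
Definition perfect U V (b : U -> V -> k) :=
  [/\ forall v, linear (fun u => b u v : k^o),
      forall u, linear (b u : V -> k^o),
      forall u, (forall v, b u v = 0) -> u = 0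
    & forall v, (forall u, b u v = 0) -> v = 0].

Lemma perfect_flip U V (b : U -> V -> k) :
  perfect b -> perfect (fun v u => b u v).
Proof. by case. Qed.

Lemma perfect_inj U V (b : U -> V -> k) v v' :
  perfect b -> (forall u, b u v = b u v') -> v = v'.
Proof.
move=> [_ linr _ sepV] e; apply/eqP; rewrite -subr_eq0; apply/eqP/sepV => u.
rewrite -[v - v']addrC -scaleN1r linr e.
by rewrite scaleN1r addNr.
Qed.

Lemma perfect_dim U V (b : U -> V -> k) : perfect b -> (dim U <= dim V)%N.
Proof.
move=> bP; have [linl linr sepU _] := bP.
have Bl : linear (fun u => lfun_of (linr u)).
  move=> a x y; apply/lfunP => v.
  by rewrite add_lfunE scale_lfunE !lfun_ofE linl.
have /lker0P/eqP kerB : injective (lfun_of Bl).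
  move=> x y; rewrite !lfun_ofE => /lfunP e.
  apply: (perfect_inj (perfect_flip bP)) => v.
  by have := e v; rewrite !lfun_ofE.
have := limg_ker_dim (lfun_of Bl) fullv.
rewrite kerB capv0 dimv0 add0n dimvf => <-.
apply: leq_trans (dimvS (subvf _)) _.
by rewrite dimvf /dim /= muln1.
Qed.

(** The map V -> U^* induced by the pairing is injective, and it is onto because
    nondegeneracy on the other side bounds dim U by dim V. *)
Lemma perfect_repr U V (b : U -> V -> k) (psi : U -> k^o) :
  perfect b -> linear psi -> exists v, forall u, psi u = b u v.
Proof.
move=> bP psil; have [linl linr _ sepV] := bP.
have Bl : linear (fun v => lfun_of (linl v)).
  move=> a x y; apply/lfunP => u.
  by rewrite add_lfunE scale_lfunE !lfun_ofE linr.
have /lker0P/eqP kerB : injective (lfun_of Bl).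
  move=> x y; rewrite !lfun_ofE => /lfunP e.
  by apply: (perfect_inj bP) => u; have := e u; rewrite !lfun_ofE.
have imB : limg (lfun_of Bl) = fullv.
  apply/eqP; rewrite eqEdim subvf /=.
  have := limg_ker_dim (lfun_of Bl) fullv.
  rewrite kerB capv0 dimv0 add0n => ->; rewrite !dimvf [dim 'Hom(_, _)]/dim /= muln1.
  exact: perfect_dim bP.
have /memv_imgP[v _ e] : lfun_of psil \in limg (lfun_of Bl).
  by rewrite imB memvf.
by exists v => u; rewrite -(lfun_ofE psil) e !lfun_ofE.
Qed.

(** The uniqueness in [perfect_repr] makes the representing vector depend
    linearly on the functional. *)
Lemma perfect_map U V W (b : U -> V -> k) (beta : U -> W -> k) :
  perfect b -> (forall w, linear (fun u => beta u w : k^o)) ->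
  (forall u, linear (beta u : W -> k^o)) ->
  exists2 phi : W -> V, linear phi & forall u w, beta u w = b u (phi w).
Proof.
move=> bP bl br; have /choice[phi phiE] w := perfect_repr bP (bl w).
exists phi => // a x y; apply: (perfect_inj bP) => u.
by case: bP => _ linr _ _; rewrite linr -!phiE br.
Qed.

Lemma perfect_transport U V U' V' (b : U -> V -> k) (p : U' -> U) (q : V' -> V) :
  perfect b -> linear p -> bijective p -> linear q -> bijective q ->
  perfect (fun u v => b (p u) (q v)).
Proof.
move=> [linl linr sepU sepV] pl [p' pK p'K] ql [q' qK q'K].
split=> [v a x y|u a x y|u u0|v v0]; first by rewrite pl linl.
- by rewrite ql linr.
- rewrite -(pK u) (sepU (p u)) ?(lin0 (linear_can pl pK p'K)) // => v.
  by rewrite -(q'K v).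
- rewrite -(qK v) (sepV (q v)) ?(lin0 (linear_can ql qK q'K)) // => u.
  by rewrite -(p'K u).
Qed.

End LinearAlgebra.

(** * Categories, adjunctions and projective generators *)

Section Categories.

Lemma isomorphic_refl (C : category) (X : C) : isomorphic X X.
Proof. by exists (idc X), (idc X); split; rewrite comp1c. Qed.

Lemma isomorphic_sym (C : category) (X Y : C) :
  isomorphic X Y -> isomorphic Y X.
Proof. by case=> f [g [gf fg]]; exists g, f. Qed.

Lemma isomorphic_trans (C : category) (X Y Z : C) :
  isomorphic X Y -> isomorphic Y Z -> isomorphic X Z.
Proof.
move=> [f [g [gf fg]]] [f' [g' [gf' fg']]].
exists (f' \oc f), (g \oc g'); split.
  by rewrite compcA -(compcA g) gf' compc1.
by rewrite compcA -(compcA f') fg compc1.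
Qed.

Lemma functor_isomorphic (C D : category) (F : functor C D) (X Y : C) :
  isomorphic X Y -> isomorphic (F X) (F Y).
Proof.
move=> [f [g [gf fg]]]; exists (fmap F f), (fmap F g).
by split; rewrite -fmapM ?gf ?fg fmap1.
Qed.

Lemma faithful_of_retraction (C D : category) (F : functor C D)
    (G : functor D C) : nat_isomorphic (comp_functor G F) (id_functor C) ->
  forall X Y (f g : Hom X Y), fmap F f = fmap F g -> f = g.
Proof.
move=> [a [b ab]] X Y f g e.
have aE (h : Hom X Y) : h = a Y \oc fmap G (fmap F h) \oc b X.
  by have /= -> := ncomp_nat a h; rewrite -compcA (ab X).2 compc1.
by rewrite (aE f) e -aE.
Qed.

(** Fullness needs the faithfulness of the inverse equivalence. *)
Lemma equivalence_fully_faithful (C D : category) (F : functor C D) :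
  is_equivalence F ->
  forall X Y (g : Hom (F X) (F Y)), exists! f : Hom X Y, fmap F f = g.
Proof.
move=> [G [GF FG]] X Y g.
have faithF := faithful_of_retraction GF.
have faithG := faithful_of_retraction FG.
have [a [b ab]] := GF.
exists (a Y \oc fmap G g \oc b X); split=> [|f <-]; last first.
  by have /= -> := ncomp_nat a f; rewrite -compcA (ab X).2 compc1.
apply: faithG; rewrite -[RHS]comp1c -(ab Y).1 -[RHS]compc1 -(ab X).1.
set f := _ \oc b X.
have /= e := ncomp_nat a f.
by rewrite -[LHS]comp1c -(ab Y).1 -(compcA (b Y)) e !compcA.
Qed.

End Categories.

Section AdjunctionMaps.
Variables (C D : category) (G : functor C D) (H : functor D C).
Variable adj : adjunction G H.

(** The two directions of the bijection Hom(G X, Y) = Hom(X, H Y). *)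
Definition adj_r X Y (f : Hom (G X) Y) : Hom X (H Y) :=
  fmap H f \oc adj_unit adj X.
Definition adj_l X Y (g : Hom X (H Y)) : Hom (G X) Y :=
  adj_counit adj Y \oc fmap G g.

Lemma adj_r_post X Y Y' (k : Hom Y Y') (f : Hom (G X) Y) :
  adj_r (k \oc f) = fmap H k \oc adj_r f.
Proof. by rewrite /adj_r fmapM compcA. Qed.

Lemma adj_r_pre X X' Y (f : Hom (G X') Y) (h : Hom X X') :
  adj_r (f \oc fmap G h) = adj_r f \oc h.
Proof.
rewrite /adj_r fmapM -!compcA; congr (_ \oc _).
by have /= <- := ncomp_nat (adj_unit adj) h.
Qed.

Lemma adj_l_pre X X' Y (g : Hom X' (H Y)) (h : Hom X X') :
  adj_l (g \oc h) = adj_l g \oc fmap G h.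
Proof. by rewrite /adj_l fmapM compcA. Qed.

Lemma adj_rK X Y : cancel (@adj_r X Y) (@adj_l X Y).
Proof.
move=> f; rewrite /adj_r adj_l_pre /adj_l.
have /= -> := ncomp_nat (adj_counit adj) f.
by rewrite -compcA adj_triL compc1.
Qed.

Lemma adj_lK X Y : cancel (@adj_l X Y) (@adj_r X Y).
Proof.
move=> g; rewrite /adj_l adj_r_post /adj_r.
have /= <- := ncomp_nat (adj_unit adj) g.
by rewrite compcA adj_triR comp1c.
Qed.

End AdjunctionMaps.

(** Linearity and perfectness phrased on the morphism types of the underlying
    categories, so that arguments remain composable. *)
Definition hom_linear (k : fieldType) (C D : linCat k) (X Y : C) (X' Y' : D)
    (phi : Hom X Y -> Hom X' Y') :=
  linear (phi : homV X Y -> homV X' Y').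

Definition hom_perfect (k : fieldType) (C D : linCat k) (X Y : C) (X' Y' : D)
    (b : Hom X Y -> Hom X' Y' -> k) :=
  @perfect k (homV X Y) (homV X' Y') b.

Section LinearCategories.
Variables (k : fieldType) (C : linCat k).
Implicit Types X Y Z I : C.

Definition sumc n X Y (f : 'I_n -> Hom X Y) : Hom X Y :=
  \sum_i (f i : homV X Y).

Lemma eq_sumc n X Y (f g : 'I_n -> Hom X Y) : f =1 g -> sumc f = sumc g.
Proof. by move=> e; apply: eq_bigr => i _; apply: e. Qed.

Lemma sumc_comp n X Y Z (f : 'I_n -> Hom Y Z) (g : Hom X Y) :
  sumc f \oc g = sumc (fun i => f i \oc g).
Proof. exact: (linear_sum (@precomp_fun k C X Y Z g)). Qed.

Lemma comp_sumc n X Y Z (f : 'I_n -> Hom X Y) (g : Hom Y Z) :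
  g \oc sumc f = sumc (fun i => g \oc f i).
Proof. exact: (linear_sum (@postcomp_fun k C X Y Z g)). Qed.

(** Finite families stand in for epimorphisms out of direct sums: neither
    direct sums nor quotients then have to be constructed. *)
Definition jointly_epic n (X : 'I_n -> C) Y (e : forall i, Hom (X i) Y) :=
  forall Z (f g : Hom Y Z), (forall i, f \oc e i = g \oc e i) -> f = g.

Definition projective I :=
  forall n (X : 'I_n -> C) Y (e : forall i, Hom (X i) Y), jointly_epic e ->
  forall f : Hom I Y, exists s : forall i, Hom I (X i),
  f = sumc (fun i => e i \oc s i).

Lemma retract_projective I J (s : Hom J I) (r : Hom I J) :
  r \oc s = idc J -> projective I -> projective J.
Proof.
move=> rs projI n X Y e eP f.
have [t ft] := projI _ _ _ _ eP (f \oc r).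
exists (fun i => t i \oc s).
have -> : f = f \oc r \oc s by rewrite -compcA rs compc1.
by rewrite ft sumc_comp; apply: eq_sumc => i; rewrite compcA.
Qed.

(** The features of the regular module that are used below: Hom(Q, -) is
    faithful and full onto End(Q)-linear maps, and the dual of the left
    End(Q)-module Hom(Z, Q) is of the form Hom(Q, N). *)
Record generator (Q : C) : Prop := Generator {
  gen_faithful : forall X Y (f g : Hom X Y),
    (forall x : Hom Q X, f \oc x = g \oc x) -> f = g;
  gen_full : forall X Y (phi : Hom Q X -> Hom Q Y), hom_linear phi ->
    (forall (x : Hom Q X) (a : Hom Q Q), phi (x \oc a) = phi x \oc a) ->
    exists f : Hom X Y, forall x, phi x = f \oc x;
  gen_dual : forall Z, exists N (b : Hom Z Q -> Hom Q N -> k), hom_perfect b /\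
    forall (a : Hom Q Q) (z : Hom Z Q) (x : Hom Q N),
    b (a \oc z) x = b z (x \oc a)
}.

End LinearCategories.

Lemma modHomE (k : fieldType) (A : fdAlgebra k) (M N : rightModule A)
    (f : modHomT M N) m a : vsval f (ract m a) = ract (vsval f m) a.
Proof. by have /modHomP := subvsP f; apply. Qed.

Lemma modHom_of (k : fieldType) (A : fdAlgebra k) (M N : rightModule A)
    (f : M -> N) : linear f -> (forall m a, f (ract m a) = ract (f m) a) ->
  exists g : @Hom (modCat A) M N, vsval (g : modHomT M N) =1 f.
Proof.
move=> fl fE; have gM : lfun_of fl \in modHom M N.
  by apply/modHomP => m a; rewrite !lfun_ofE.
by exists (Subvs gM : modHomT M N) => m /=; rewrite lfun_ofE.
Qed.

Section Fibre.
Variables (k : fieldType) (C : linCat k) (A : fdAlgebra k).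
Variables (F : functor C (modCat A)) (G : functor (modCat A) C).
Hypotheses (F_lin : linear_functor F).
Hypothesis GF : nat_isomorphic (comp_functor G F) (id_functor C).
Hypothesis FG : nat_isomorphic (comp_functor F G) (id_functor (modCat A)).

Let F_ff := equivalence_fully_faithful (ex_intro _ G (conj GF FG)).

Definition regular : modCat A :=
  RightModule (@amulA k A) (@amul1r k A) (@amul_linl k A) (@amul_linr k A).

Definition modfun (M N : modCat A) (f : Hom M N) (m : mcar M) : mcar N :=
  vsval (f : modHomT M N) m.

Lemma modfun_comp (M N P : modCat A) (g : Hom N P) (f : Hom M N) m :
  modfun (g \oc f) m = modfun g (modfun f m).
Proof. exact: comp_lfunE. Qed.

Lemma modfun_ract (M N : modCat A) (f : Hom M N) m a :
  modfun f (ract m a) = ract (modfun f m) a.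
Proof. exact: modHomE. Qed.

Lemma modfun_id (M : modCat A) m : modfun (idc M) m = m.
Proof. exact: id_lfunE. Qed.

Lemma modfun_inj (M N : modCat A) (f g : Hom M N) : modfun f =1 modfun g -> f = g.
Proof. by move=> e; apply: subvs_inj; apply/lfunP. Qed.

(** Q is the preimage of the regular module, so that Hom(Q, X) is the module
    F X itself.  The algebra element a acts on Q by the endomorphism that
    corresponds to left multiplication by a. *)
Lemma fibre_functor : exists (Q : C) (ev : forall X, Hom Q X -> mcar (F X))
    (act : A -> Hom Q Q),
  [/\ forall X, linear (ev X : homV Q X -> mcar (F X)),
      forall X, bijective (ev X),
      forall X Y (f : Hom X Y) x, ev Y (f \oc x) = modfun (fmap F f) (ev X x),
      forall X (x : Hom Q X) a, ev X (x \oc act a) = ract (ev X x) a &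
      forall g, exists a, g = act a].
Proof.
have [c [d cd]] := FG; pose Q := G regular.
pose p : Hom (F Q) regular := c regular.
pose p' : Hom regular (F Q) := d regular.
have p'p : p' \oc p = idc (F Q) := (cd regular).1.
have pp' : p \oc p' = idc regular := (cd regular).2.
pose q0 := modfun p' (aone A).
have q0E m : m = ract q0 (modfun p m).
  by rewrite -modfun_ract /= amul1l -modfun_comp p'p modfun_id.
pose ev X (x : Hom Q X) := modfun (fmap F x) q0.
have ev_nat X Y (f : Hom X Y) x : ev Y (f \oc x) = modfun (fmap F f) (ev X x).
  by rewrite /ev fmapM modfun_comp.
have ev_inj X : injective (ev X).
  move=> x y e; have [f [_ fU]] := F_ff (fmap F x).
  rewrite -(fU x) // -(fU y) //; apply: modfun_inj => m.
  by rewrite (q0E m) !modfun_ract (e : modfun _ q0 = modfun _ q0).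
have ev_surj X m : exists x, ev X x = m.
  have [|a b|h hE] := @modHom_of k A regular (F X) (fun a => ract m a).
  - exact: ract_linr.
  - exact: ractM.
  have [x [xE _]] := F_ff (h \oc p); exists x.
  rewrite /ev xE modfun_comp /q0 -(modfun_comp p) pp' modfun_id.
  by rewrite [LHS]hE ract1.
have ev_bij X : bijective (ev X).
  have [g gE] := choice (ev_surj X).
  by exists g => x //; apply: ev_inj; rewrite gE.
have [act actE] := choice (fun a => ev_surj Q (ract q0 a)).
have ev_act X (x : Hom Q X) a : ev X (x \oc act a) = ract (ev X x) a.
  by rewrite ev_nat actE modfun_ract.
exists Q, ev, act; split=> //.
  by move=> X a x y; rewrite /ev /modfun [fmap F _]F_lin add_lfunE scale_lfunE.
move=> g; exists (modfun p (ev Q g)); apply: ev_inj.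
by rewrite actE -q0E.
Qed.

End Fibre.

(** For [gen_dual], the dual of Hom(Z, Q) is made into a right module through
    the action on Q, and N is the object corresponding to it. *)
Lemma finite_generator (k : fieldType) (C : linCat k) :
  finite_category C -> exists Q : C, generator Q.
Proof.
move=> [A [F [F_lin [G [GF FG]]]]].
have F_ff := equivalence_fully_faithful (ex_intro _ G (conj GF FG)).
have [Q [ev [act [ev_lin ev_bij ev_nat ev_act act_surj]]]] := fibre_functor F_lin GF FG.
have ev_inj X := bij_inj (ev_bij X).
exists Q; split.
- move=> X Y f g fg; have [h [_ hU]] := F_ff _ _ (fmap F f).
  rewrite -(hU f) // -(hU g) //; apply: modfun_inj => m.
  by have [ev' _ evK] := ev_bij X; rewrite -(evK m) -!ev_nat fg.
- move=> X Y phi phi_lin phiE; have [ev' evK ev'K] := ev_bij X.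
  have ev'_lin := linear_can (ev_lin X) evK ev'K.
  have [||h hE] := @modHom_of k A (F X) (F Y) (fun m => ev Y (phi (ev' m))).
  + by move=> a x y; rewrite ev'_lin phi_lin ev_lin.
  + move=> m a; rewrite -ev_act -phiE; congr (ev Y (phi _)).
    by apply: ev_inj; rewrite ev_act !ev'K.
  have [f [fE _]] := F_ff _ _ h; exists f => x.
  by apply: ev_inj; rewrite ev_nat fE [RHS]hE evK.
move=> Z.
have actD z : linear (fun a => act a \oc z : homV Z Q).
  have actl : linear (act : A -> homV Q Q).
    move=> a x y; apply: ev_inj; rewrite ev_lin.
    rewrite -(comp1c (act _)) -(comp1c (act x)) -(comp1c (act y)) !ev_act.
    exact: ract_linr.
  by move=> a x y; rewrite actl comp_linl.
have actM a b : act (amul a b) = act a \oc act b.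
  apply: ev_inj; rewrite ev_act -(comp1c (act (amul a b))) ev_act ractM.
  by rewrite -ev_act comp1c.
have act1 : act (aone A) = idc Q.
  by apply: ev_inj; rewrite -(comp1c (act _)) ev_act ract1.
pose V := linear_dual (homV Z Q).
pose dact (psi : V) (a : A) : V := (psi \o postcomp Z (act a))%VF.
have dactE psi a z : dact psi a z = psi (act a \oc z).
  by rewrite comp_lfunE postcompE.
have [] : [/\ forall psi a b, dact psi (amul a b) = dact (dact psi a) b,
    forall psi, dact psi (aone A) = psi, forall a, linear (dact^~ a)
    & forall psi, linear (dact psi)].
  split=> [psi a b|psi|a c x y|psi c x y]; apply/lfunP => z.
  - by rewrite !dactE actM compcA.
  - by rewrite dactE act1 comp1c.
  - by rewrite add_lfunE scale_lfunE !dactE add_lfunE scale_lfunE.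
  - by rewrite add_lfunE scale_lfunE !dactE (actD z) linearP.
move=> dM d1 dl dr.
pose N := RightModule dM d1 dl dr.
have [c [d cd]] := FG.
pose nu (x : Hom Q (G N)) : V := modfun (c N) (ev _ x).
exists (G N), (fun z x => nu x z); split; last first.
  move=> g z x; have [a ->] := act_surj g.
  by rewrite /nu ev_act modfun_ract [RHS]dactE.
have nuK : bijective nu.
  have [ev' evK ev'K] := ev_bij (G N).
  exists (fun psi => ev' (modfun (d N) psi)) => x.
    by rewrite /nu -modfun_comp (cd N).1 modfun_id evK.
  by rewrite /nu ev'K -modfun_comp (cd N).2 modfun_id.
have nu_lin : linear (nu : homV Q (G N) -> V).
  by move=> a x y; rewrite /nu ev_lin [LHS]linearP.
split=> [x a z z'|z a x y|z z0|x x0].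
- exact: linearP.
- by rewrite nu_lin add_lfunE scale_lfunE.
- apply: functionals_separate => psi.
  by have [nu' _ nuK'] := nuK; rewrite -(nuK' psi).
- have [nu' nuK' nu'K] := nuK; rewrite -(nuK' x).
  have -> : nu x = 0 by apply/lfunP => z; rewrite zero_lfunE x0.
  exact: lin0 (linear_can nu_lin nuK' nu'K).
Qed.

(** * Projective objects and Nakayama pairings *)

Section HomPairings.
Variables (k : fieldType) (C D E : linCat k).
Variables (X Y : C) (X' Y' : D) (X'' Y'' : E).
Variable b : Hom X Y -> Hom X' Y' -> k.
Hypothesis bP : hom_perfect b.

Lemma hom_perfect_inj v v' : (forall u, b u v = b u v') -> v = v'.
Proof. exact: (perfect_inj bP). Qed.

Lemma hom_perfect_map (beta : Hom X Y -> Hom X'' Y'' -> k) :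
  (forall w, linear (fun u : homV X Y => beta u w : k^o)) ->
  (forall u, linear (beta u : homV X'' Y'' -> k^o)) ->
  exists2 phi : Hom X'' Y'' -> Hom X' Y', hom_linear phi &
    forall u w, beta u w = b u (phi w).
Proof. exact: (perfect_map bP). Qed.

End HomPairings.

Lemma hom_perfect_transport (k : fieldType) (C D C' D' : linCat k) (X Y : C)
    (X' Y' : D) (U V : C') (U' V' : D') (b : Hom X Y -> Hom X' Y' -> k)
    (p : Hom U V -> Hom X Y) (q : Hom U' V' -> Hom X' Y') :
  hom_perfect b -> hom_linear p -> bijective p -> hom_linear q ->
  bijective q -> hom_perfect (fun u v => b (p u) (q v)).
Proof. exact: perfect_transport. Qed.

Section Projectives.
Variables (k : fieldType) (C : linCat k).
Implicit Types X Y Z I : C.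

Lemma comp_linear_l X Y Z (f : Hom X Y) :
  hom_linear (fun g : Hom Y Z => g \oc f).
Proof. exact: comp_linl. Qed.

Lemma comp_linear_r X Y Z (g : Hom Y Z) :
  hom_linear (fun f : Hom X Y => g \oc f).
Proof. exact: comp_linr. Qed.

Lemma compcZ X Y Z (g : Hom Y Z) a (f : Hom X Y) :
  g \oc (a *: (f : homV X Y) : homV X Y) = a *: (g \oc f : homV X Z) :> homV X Z.
Proof. exact: (linearZ_LR (@postcomp_fun k C X Y Z g)). Qed.

(** If the maps e_i o s did not span Hom(Q, Y), a nonzero functional on
    Hom(Q, Y) would kill them; through [gen_dual] at Z = Q it becomes a morphism
    h out of Y with h o e_i = 0 for all i, contradicting joint epicness. *)
Lemma generator_projective (Q : C) : generator Q -> projective Q.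
Proof.
move=> QP n X Y e eP f.
pose S := (\sum_i limg (postcomp Q (e i)))%VS.
suff /memv_sumP[v vS ->] : (f : homV Q Y) \in S.
  have vE i : exists s, v i = e i \oc s :> Hom Q Y.
    have /memv_imgP[s _ ->] := vS i isT.
    by exists s; rewrite postcompE.
  exists (fun i => projT1 (cid (vE i))).
  by apply: eq_bigr => i _; apply: projT2 (cid (vE i)).
apply: mem_of_functionals => psi psiS.
have [N [b [bP bE]]] := gen_dual QP Q.
have [||phi phi_lin phiE] := hom_perfect_map
  (beta := fun (a : Hom Q Q) (y : Hom Q Y) => psi (y \oc a)) bP.
- by move=> y c a a'; rewrite [_ \oc _]comp_linear_r linearP.
- by move=> a c y y'; rewrite [_ \oc _]comp_linear_l linearP.
have [//|x a|h hE] := gen_full QP (phi := phi).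
  apply: (hom_perfect_inj bP) => c.
  by rewrite -phiE -[RHS]bE -phiE compcA.
have h0 : h = (0 : homV Y N).
  apply: eP => i; rewrite comp0c; apply: (gen_faithful QP) => x.
  rewrite comp0c -compcA -hE; apply: (hom_perfect_inj bP) => a.
  case: (bP) => _ linr _ _; rewrite -phiE (lin0 (linr a)); apply: psiS.
  apply: (subvP (sumv_sup i _ (subvv _))) => //.
  by rewrite -compcA -postcompE memv_img ?memvf.
case: (bP) => _ linr _ _.
by rewrite -(compc1 f) phiE hE h0 comp0c (lin0 (linr _)).
Qed.

(** A basis of Hom(Q, I) is jointly epic because Q is a generator, and the
    identity of I lifts along it. *)
Lemma projective_decomp (Q I : C) : generator Q -> projective I ->
  exists n (r : 'I_n -> Hom Q I) (s : 'I_n -> Hom I Q),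
  idc I = sumc (fun i => r i \oc s i).
Proof.
move=> QP projI; pose B : seq (homV Q I) := vbasis fullv.
pose r (i : 'I_(\dim {: homV Q I})) : Hom Q I := B`_i.
have rP : jointly_epic r.
  move=> Z f g fg; apply: (gen_faithful QP) => x.
  have -> : x = sumc (fun i => r i \oc (coord (vbasis fullv) i x *: (idc Q : homV Q Q))).
    rewrite {1}(coord_vbasis (memvf (x : homV Q I))); apply: eq_bigr => i _.
    by rewrite compcZ compc1.
  by rewrite !comp_sumc; apply: eq_sumc => i; rewrite !compcA fg.
by have [s] := projI _ _ _ _ rP (idc I); exists (\dim {: homV Q I}), r, s.
Qed.

(** On projective objects this is the natural duality between Hom(Z, I) and
    Hom(I, X) that holds for X = N(Z), N being the Nakayama functor.
    The restriction to projectives is essential: in general the pairing does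
    not extend naturally to all objects. *)
Definition nakayama_pairing Z X (b : forall I, Hom Z I -> Hom I X -> k) :=
  (forall I, projective I -> hom_perfect (b I)) /\
  (forall I J (g : Hom I J) z x, projective I -> projective J ->
    b J (g \oc z) x = b I z (x \oc g)).

Definition nakayama Z X := exists b, @nakayama_pairing Z X b.

(** A decomposition id_I = sum of r_i o s_i through Q extends the pairing to I by
    the trace-like formula b_I(z, x) = sum of b(s_i o z, x o r_i), which
    naturality forces. *)
Lemma nakayama_of_generator (Q Z N : C) (b : Hom Z Q -> Hom Q N -> k) :
  generator Q -> hom_perfect b ->
  (forall (a : Hom Q Q) (z : Hom Z Q) (x : Hom Q N),
    b (a \oc z) x = b z (x \oc a)) -> nakayama Z N.
Proof.
move=> QP bP bE; have [linl linr sepl sepr] := bP.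
pose data I := {n & (('I_n -> Hom Q I) * ('I_n -> Hom I Q))%type}.
have decomp I : exists p : data I, projective I ->
    idc I = sumc (fun i => (projT2 p).1 i \oc (projT2 p).2 i).
  have [projI|nproj] := pselect (projective I).
    by have [n [r [s rs]]] := projective_decomp QP projI; exists (existT _ n (r, s)).
  (* A default for the objects on which the pairing is not constrained. *)
  by exists (existT _ 0%N (fun=> 0 : homV _ _, fun=> 0 : homV _ _)).
have [m [r [s rs]]] : exists m (r : forall I, 'I_(m I) -> Hom Q I)
    (s : forall I, 'I_(m I) -> Hom I Q), forall I, projective I ->
    idc I = sumc (fun i => r I i \oc s I i).
  pose d I := projT1 (cid (decomp I)).
  exists (fun I => projT1 (d I)), (fun I => (projT2 (d I)).1),
    (fun I => (projT2 (d I)).2).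
  by move=> I; apply: projT2 (cid (decomp I)).
have bsl n (f : 'I_n -> Hom Z Q) x : b (sumc f) x = \sum_i b (f i) x.
  exact: form_sum f (linl x).
have bsr n (f : 'I_n -> Hom Q N) z : b z (sumc f) = \sum_i b z (f i).
  exact: form_sum f (linr z).
pose B I (z : Hom Z I) (x : Hom I N) := \sum_i b (s I i \oc z) (x \oc r I i).
have Bl I x : linear (fun z : homV Z I => B I z x : k^o).
  move=> a z z'; rewrite /B scaler_sumr -big_split; apply: eq_bigr => i _; cbv beta.
  by rewrite [_ \oc _]comp_linear_r linl.
have Br I z : linear (fun x : homV I N => B I z x : k^o).
  move=> a x x'; rewrite /B scaler_sumr -big_split; apply: eq_bigr => i _; cbv beta.
  by rewrite [_ \oc r I i]comp_linear_l linr.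
have Bnat I J (g : Hom I J) z x : projective I -> projective J ->
    B J (g \oc z) x = B I z (x \oc g).
  move=> projI projJ; transitivity
    (\sum_j \sum_i b (s J j \oc g \oc r I i \oc s I i \oc z) (x \oc r J j)).
    apply: eq_bigr => j _; rewrite -bsl; congr (b _ _).
    rewrite -[g in LHS]compc1 (rs I projI) comp_sumc sumc_comp comp_sumc.
    by apply: eq_sumc => i; rewrite !compcA.
  rewrite exchange_big; apply: eq_bigr => i _; cbv beta.
  rewrite -[x in RHS]compc1 (rs J projJ) comp_sumc !sumc_comp bsr.
  apply: eq_bigr => j _; rewrite -(compcA (s J j \oc g \oc r I i)) bE.
  by rewrite !compcA.
have bB I z x i : projective I -> B I (r I i \oc z) x = b z (x \oc r I i).
  move=> projI.
  rewrite -[x in RHS]compc1 (rs I projI) comp_sumc sumc_comp bsr.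
  by apply: eq_bigr => j _; rewrite compcA bE !compcA.
have bB' I z x i : projective I -> B I z (x \oc s I i) = b (s I i \oc z) x.
  move=> projI.
  rewrite -[z in RHS]comp1c (rs I projI) sumc_comp comp_sumc bsl.
  by apply: eq_bigr => j _; rewrite -compcA -bE !compcA.
exists B; split=> // I projI.
suff [Bsepl Bsepr] :
    (forall z : Hom Z I, (forall x, B I z x = 0) -> z = (0 : homV Z I)) /\
    (forall x : Hom I N, (forall z, B I z x = 0) -> x = (0 : homV I N)) by [].
split=> [z z0|x x0].
  rewrite -(comp1c z) (rs I projI) sumc_comp; apply: big1 => i _.
  rewrite -compcA (_ : s I i \oc z = (0 : homV Z Q)) ?compc0 //.
  by apply: sepl => x; rewrite -bB'.
rewrite -(compc1 x) (rs I projI) comp_sumc; apply: big1 => i _.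
rewrite compcA (_ : x \oc r I i = (0 : homV Q N)) ?comp0c //.
by apply: sepr => z; rewrite -bB.
Qed.

Lemma nakayama_exists (Q Z : C) : generator Q -> exists N, nakayama Z N.
Proof.
move=> QP; have [N [b [bP bE]]] := gen_dual QP Z.
by exists N; apply: nakayama_of_generator QP bP bE.
Qed.

(** On Q both Hom(Q, X) and Hom(Q, X') are dual to Hom(Z, Q), compatibly with
    End(Q), and the resulting map between them is induced by a morphism. *)
Lemma nakayama_hom (Q Z X X' : C) : generator Q ->
  forall (b : forall I, Hom Z I -> Hom I X -> k) b',
  nakayama_pairing b -> nakayama_pairing b' ->
  exists f : Hom X X', forall z x, b Q z x = b' Q z (f \oc x).
Proof.
move=> QP b b' [bP bE] [b'P b'E]; have projQ := generator_projective QP.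
have [linl linr _ _] := bP Q projQ.
have [phi phi_lin phiE] := hom_perfect_map (b'P Q projQ) linl linr.
have [x a|f fE] := gen_full QP phi_lin.
  apply: (hom_perfect_inj (b'P Q projQ)) => z.
  by rewrite -phiE -bE // -b'E // phiE.
by exists f => z x; rewrite phiE fE.
Qed.

Lemma nakayama_unique (Q Z X X' : C) : generator Q ->
  nakayama Z X -> nakayama Z X' -> isomorphic X X'.
Proof.
move=> QP [b bP] [b' b'P]; have projQ := generator_projective QP.
have [f fE] := nakayama_hom QP bP b'P; have [g gE] := nakayama_hom QP b'P bP.
exists f, g; split; apply: (gen_faithful QP) => x.
  apply: (hom_perfect_inj (bP.1 Q projQ)) => z.
  by rewrite comp1c -compcA -gE -fE.
apply: (hom_perfect_inj (b'P.1 Q projQ)) => z.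
by rewrite comp1c -compcA -fE -gE.
Qed.

End Projectives.

Lemma hom_linear_can (k : fieldType) (C D : linCat k) (X Y : C) (X' Y' : D)
    (f : Hom X Y -> Hom X' Y') g :
  hom_linear f -> cancel f g -> cancel g f -> hom_linear g.
Proof. exact: linear_can. Qed.

Section Transport.
Variables (k : fieldType) (C D : linCat k).

(** Pulling the pairing back along a functor G that has a left adjoint (seen
    by p at Z) and a right adjoint (seen by q at X). *)
Lemma nakayama_transport (G : functor D C) (Z X : C) (Z' X' : D)
    (p : forall I, Hom Z' I -> Hom Z (G I)) (q : forall I, Hom I X' -> Hom (G I) X) :
  nakayama Z X -> (forall I, projective I -> projective (G I)) ->
  (forall I, hom_linear (p I)) -> (forall I, bijective (p I)) ->
  (forall I J (g : Hom I J) z, p J (g \oc z) = fmap G g \oc p I z) ->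
  (forall I, hom_linear (q I)) -> (forall I, bijective (q I)) ->
  (forall I J (g : Hom I J) x, q I (x \oc g) = q J x \oc fmap G g) ->
  nakayama Z' X'.
Proof.
move=> [b [bP bE]] projG pl pb pE ql qb qE.
exists (fun I z x => b (G I) (p I z) (q I x)); split=> [I projI|I J g z x projI projJ].
  by apply: (hom_perfect_transport (bP _ (projG _ projI))).
by rewrite pE qE bE //; apply: projG.
Qed.

Lemma isomorphic_nakayama (Z Z' X X' : C) :
  isomorphic Z Z' -> isomorphic X X' -> nakayama Z X -> nakayama Z' X'.
Proof.
move=> [f [f' [f'f ff']]] [g [g' [g'g gg']]] [b [bP bE]].
exists (fun I z x => b I (z \oc f) (g' \oc x)); split=> [I projI|I J h z x projI projJ].
  apply: (hom_perfect_transport (bP _ projI)).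
  - exact: comp_linear_l.
  - exists (fun z => z \oc f') => z; first by rewrite -compcA ff' compc1.
    by rewrite -compcA f'f compc1.
  - exact: comp_linear_r.
  - exists (fun z => g \oc z) => z; first by rewrite compcA gg' comp1c.
    by rewrite compcA g'g comp1c.
by rewrite -compcA bE // compcA.
Qed.

Lemma adj_r_linear (G : functor C D) (H : functor D C) (adj : adjunction G H) X Y :
  linear_functor H -> hom_linear (@adj_r _ _ _ _ adj X Y).
Proof. by move=> Hl a f g; rewrite /adj_r [fmap H _]Hl; apply: comp_linear_l. Qed.

Lemma adj_l_linear (G : functor C D) (H : functor D C) (adj : adjunction G H) X Y :
  linear_functor G -> hom_linear (@adj_l _ _ _ _ adj X Y).
Proof. by move=> Gl a f g; rewrite /adj_l [fmap G _]Gl; apply: comp_linear_r. Qed.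

Lemma adj_r_linear_of_left (G : functor C D) (H : functor D C)
    (adj : adjunction G H) X Y :
  linear_functor G -> hom_linear (@adj_r _ _ _ _ adj X Y).
Proof.
move=> Gl; apply: (hom_linear_can (f := @adj_l _ _ _ _ adj X Y)).
- exact: adj_l_linear.
- exact: adj_lK.
- exact: adj_rK.
Qed.

Lemma adj_l_linear_of_right (G : functor C D) (H : functor D C)
    (adj : adjunction G H) X Y :
  linear_functor H -> hom_linear (@adj_l _ _ _ _ adj X Y).
Proof.
move=> Hl; apply: (hom_linear_can (f := @adj_r _ _ _ _ adj X Y)).
- exact: adj_r_linear.
- exact: adj_rK.
- exact: adj_lK.
Qed.

Lemma left_adjoint_jointly_epic (G : functor C D) (H : functor D C)
    (adj : adjunction G H) n (X : 'I_n -> C) Y (e : forall i, Hom (X i) Y) :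
  jointly_epic e -> jointly_epic (fun i => fmap G (e i)).
Proof.
move=> eP Z f g fg; rewrite -(adj_rK adj f) -(adj_rK adj g); congr adj_l.
by apply: eP => i; rewrite -!adj_r_pre fg.
Qed.

End Transport.

Lemma linear_fmap_sumc (k : fieldType) (C D : linCat k) (H : functor C D) X Y n
    (f : 'I_n -> Hom X Y) : linear_functor H ->
  fmap H (sumc f) = sumc (fun i => fmap H (f i)).
Proof.
move=> Hl; have fl : linear (fmap H : homV X Y -> homV (H X) (H Y)) by apply: Hl.
transitivity (lfun_of fl (sumc f)); first by rewrite lfun_ofE.
by rewrite linear_sum; apply: eq_bigr => i _; apply: (lfun_ofE fl).
Qed.

(** The right adjoint H is itself a left adjoint, hence preserves jointly
    epic families; a lifting problem for G I is one for I after applying H. *)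
Lemma left_adjoint_projective (k : fieldType) (C D : linCat k)
    (G : functor C D) (H : functor D C) (K : functor C D) (I : C) :
  adjunction G H -> adjunction H K -> linear_functor H ->
  projective I -> projective (G I).
Proof.
move=> adj adj' Hl projI n X Y e eP f.
have [s sE] := projI _ _ _ _ (left_adjoint_jointly_epic adj' eP) (adj_r adj f).
exists (fun i => adj_l adj (s i)).
rewrite -(adj_rK adj f) -(adj_rK adj (sumc _)); congr adj_l.
rewrite sE [RHS]/adj_r (linear_fmap_sumc _ Hl) sumc_comp.
apply: eq_sumc => i; rewrite -[RHS]/(adj_r adj (e i \oc adj_l adj (s i))).
by rewrite adj_r_post adj_lK.
Qed.

(** * Reversing the tensor product *)

Lemma inverse_square (C : category) (X X' Y Y' : C) (a : Hom X Y) (a' : Hom Y X)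
    (b : Hom X' Y') (b' : Hom Y' X') (f : Hom X X') (g : Hom Y Y') :
  inverse_pair a a' -> inverse_pair b b' -> b \oc f = g \oc a ->
  b' \oc g = f \oc a'.
Proof.
move=> [a'a aa'] [b'b bb'] e.
by rewrite -[f]comp1c -b'b -[b' \oc b \oc f]compcA e -!compcA aa' compc1.
Qed.

Lemma inverse_pair_sym (C : category) (X Y : C) (f : Hom X Y) (g : Hom Y X) :
  inverse_pair f g -> inverse_pair g f.
Proof. by case. Qed.

Section Monoidal.
Variables (k : fieldType) (M : monoidalLinCat k).
Implicit Types A B W X Y Z : M.

Lemma tmor_inverse X X' Y Y' (f : Hom X X') (f' : Hom X' X) (g : Hom Y Y')
    (g' : Hom Y' Y) : inverse_pair f f' -> inverse_pair g g' ->
  inverse_pair (f \otm g) (f' \otm g').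
Proof.
by move=> [f'f ff'] [g'g gg']; split; rewrite -tmorM ?f'f ?ff' ?g'g ?gg' tmor1.
Qed.

Lemma tensor_isomorphic X X' Y Y' :
  isomorphic X X' -> isomorphic Y Y' -> isomorphic (X \ot Y) (X' \ot Y').
Proof.
move=> [f [f' fK]] [g [g' gK]]; exists (f \otm g), (f' \otm g').
exact: tmor_inverse.
Qed.

Lemma tensor_isoA X Y Z : isomorphic (X \ot Y \ot Z) (X \ot (Y \ot Z)).
Proof. by exists (tass X Y Z), (tassV X Y Z); apply: tassK. Qed.

Lemma tensor_iso1l X : isomorphic (tunit \ot X) X.
Proof. by exists (tlun X), (tlunV X); apply: tlunK. Qed.

Lemma tensor_iso1r X : isomorphic (X \ot tunit) X.
Proof. by exists (trun X), (trunV X); apply: trunK. Qed.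

Lemma tassV_nat X X' Y Y' Z Z' (f : Hom X X') (g : Hom Y Y') (h : Hom Z Z') :
  tassV X' Y' Z' \oc (f \otm (g \otm h)) = ((f \otm g) \otm h) \oc tassV X Y Z.
Proof. exact: inverse_square (tassK _ _ _) (tassK _ _ _) (tass_nat _ _ _). Qed.

Lemma trunV_nat X X' (f : Hom X X') : trunV X' \oc f = (f \otm idc tunit) \oc trunV X.
Proof. exact: inverse_square (trunK _) (trunK _) (trun_nat _). Qed.

Lemma tmor1_inverse X Y Y' (g : Hom Y Y') (g' : Hom Y' Y) :
  inverse_pair g g' -> inverse_pair (idc X \otm g) (idc X \otm g').
Proof. by apply: tmor_inverse; split; rewrite comp1c. Qed.

Lemma tmor_inverse1 X X' Y (g : Hom X X') (g' : Hom X' X) :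
  inverse_pair g g' -> inverse_pair (g \otm idc Y) (g' \otm idc Y).
Proof. by move=> gK; apply: tmor_inverse => //; split; rewrite comp1c. Qed.

Lemma inv_postl X Y Z (f : Hom Y Z) f' (g : Hom X Y) (h : Hom X Z) :
  inverse_pair f f' -> f \oc g = h -> g = f' \oc h.
Proof. by move=> [f'f _] <-; rewrite compcA f'f comp1c. Qed.

Lemma inv_prer X Y Z (f : Hom Y Z) (g : Hom X Y) g' (h : Hom X Z) :
  inverse_pair g g' -> f \oc g = h -> f = h \oc g'.
Proof. by move=> [_ gg'] <-; rewrite -compcA gg' compc1. Qed.

Lemma tlun_faithful X Y (f g : Hom X Y) :
  idc tunit \otm f = idc tunit \otm g -> f = g.
Proof.
move=> e; have := congr1 (fun u => tlun Y \oc u \oc tlunV X) e.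
by rewrite !tlun_nat -!compcA (tlunK X).2 !compc1.
Qed.

(** Kelly's argument: composing 1 \ot tlun 1 and 1 \ot trun 1 with the
    associator gives trun 1 \ot 1 in both cases. *)
Lemma tlun_trun_unit : tlun tunit = trun tunit :> Hom (tunit \ot tunit) (tunit : M).
Proof.
apply: tlun_faithful.
have e : trun (tunit \ot tunit : M) = trun tunit \otm idc tunit.
  by apply: esym; rewrite (inv_postl (trunK tunit) (trun_nat (trun tunit)))
    compcA (trunK _).1 comp1c.
rewrite (inv_prer (tassK _ _ _) (triangle tunit tunit)) -e trun_tensor.
by rewrite -compcA (tassK _ _ _).2 compc1.
Qed.

(** Both sides are inverse to the two sides of the pentagon at (Z, Y, X, W). *)
Lemma rev_pentagon W X Y Z :
  tassV (Z \ot Y) X W \oc tassV Z Y (X \ot W) =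
  (tassV Z Y X \otm idc W) \oc tassV Z (Y \ot X) W \oc (idc Z \otm tassV Y X W).
Proof.
have := pentagon Z Y X W; set l := _ \oc _ => e.
have lK : inverse_pair l (tassV (Z \ot Y) X W \oc tassV Z Y (X \ot W)).
  have [a b] := tassK Z Y (X \ot W); have [c d] := tassK (Z \ot Y) X W.
  by split; rewrite /l compcA -[X in X \oc _ = _]compcA ?a ?d compc1.
rewrite -[RHS]compc1 -lK.2 e compcA.
set r := _ \oc (tass Z Y X \otm idc W); rewrite -[LHS]comp1c; congr (_ \oc _).
apply: esym; rewrite /r !compcA.
rewrite -[X in X \oc _ \oc _ = _]compcA (tmor1_inverse _ (tassK Y X W)).1 compc1.
rewrite -[X in X \oc _ = _]compcA (tassK _ _ _).1 compc1.
exact: (tmor_inverse1 _ (tassK _ _ _)).1.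
Qed.

Lemma rev_triangle X Y :
  (trun Y \otm idc X) \oc tassV Y tunit X = idc Y \otm tlun X.
Proof. by rewrite -triangle -compcA (tassK _ _ _).2 compc1. Qed.

(** Same category, opposite tensor product.  Statements about projectives and
    Nakayama pairings do not mention the tensor product, so they are literally
    the same for [rev], and every result on right tensoring has a free mirror
    image for left tensoring. *)
Definition rev : monoidalLinCat k.
refine (@MonoidalLinCat k M (fun X Y => Y \ot X)
  (fun _ _ _ _ f g => g \otm f) tunit
  (fun X Y Z => tassV Z Y X) (fun X Y Z => tass Z Y X)
  (fun X => trun X) (fun X => trunV X) (fun X => tlun X) (fun X => tlunV X)
  (fun X Y => tmor1 Y X) _ _ _ _
  (fun X => trunK X) (fun X => tlunK X) _ (fun _ _ f => trun_nat f)
  (fun _ _ f => tlun_nat f) rev_pentagon (fun X Y => rev_triangle X Y)).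
- by move=> *; apply: tmorM.
- by move=> X X' Y Y' g; apply: tmor_linr.
- by move=> X X' Y Y' f; apply: tmor_linl.
- by move=> X Y Z; apply/inverse_pair_sym/tassK.
- by move=> *; apply: tassV_nat.
Defined.

Lemma dual_pair_rev X Y (ev : Hom (Y \ot X) tunit) (coev : Hom tunit (X \ot Y)) :
  dual_pair ev coev -> @dual_pair k rev Y X ev coev.
Proof. by case. Qed.

End Monoidal.

(** * The adjunctions given by a dual pair *)

Section TensorAdjunction.
Variables (k : fieldType) (M : monoidalLinCat k) (X Y : M).
Variables (ev : Hom (Y \ot X) tunit) (coev : Hom tunit (X \ot Y)).
Hypothesis XY : dual_pair ev coev.
Implicit Types A B : M.

Lemma tlun_tensor A B : tlun (A \ot B) = (tlun A \otm idc B) \oc tassV tunit A B.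
Proof. exact: (@trun_tensor k (rev M) B A). Qed.

Definition tensr_unit A : Hom A (A \ot X \ot Y) :=
  tassV A X Y \oc (idc A \otm coev) \oc trunV A.

Definition tensr_counit B : Hom (B \ot Y \ot X) B :=
  trun B \oc (idc B \otm ev) \oc tass B Y X.

Lemma tensr_unit_nat A A' (f : Hom A A') :
  tensr_unit A' \oc f = ((f \otm idc X) \otm idc Y) \oc tensr_unit A.
Proof.
rewrite /tensr_unit -compcA trunV_nat !compcA -tassV_nat tmor1.
by rewrite -2![in LHS]compcA [(idc A' \otm coev) \oc _]compcA tmor_swap !compcA.
Qed.

Lemma tensr_counit_nat B B' (f : Hom B B') :
  tensr_counit B' \oc ((f \otm idc Y) \otm idc X) = f \oc tensr_counit B.
Proof.
rewrite /tensr_counit -compcA tass_nat tmor1 !compcA.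
by rewrite -(compcA (trun B')) tmor_swap !compcA trun_nat.
Qed.

(** The pentagon and the triangle bring every associator to the outside;
    what remains is A tensored with the zigzag identity of X. *)
Lemma tensr_triL A :
  tensr_counit (A \ot X) \oc (tensr_unit A \otm idc X) = idc (A \ot X).
Proof.
have [zig _] := XY.
rewrite /tensr_counit /tensr_unit -!tmorMl.
have pent : tass (A \ot X) Y X \oc (tassV A X Y \otm idc X) =
    tassV A X (Y \ot X) \oc ((idc A \otm tass X Y X) \oc tass A (X \ot Y) X).
  apply: (inv_postl (tassK _ _ _)); rewrite compcA pentagon -!compcA.
  by rewrite (tmor_inverse1 _ (tassK _ _ _)).2 compc1.
have runit : trun (A \ot X) \oc tassV A X tunit = idc A \otm trun X.
  by rewrite trun_tensor -compcA (tassK _ _ _).2 compc1.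
have lunit : tass A tunit X \oc (trunV A \otm idc X) = idc A \otm tlunV X.
  have lK := tmor1_inverse A (tlunK X); rewrite (inv_postl lK (triangle A X)).
  by rewrite -compcA (tmor_inverse1 _ (trunK _)).2 compc1.
rewrite -!compcA (compcA (tass (A \ot X) Y X)) pent -!compcA.
rewrite (compcA (idc (A \ot X) \otm ev)) -tmor1 -tassV_nat -!compcA.
rewrite (compcA (trun _)) runit (compcA (tass A (X \ot Y) X)) tass_nat.
by rewrite -!compcA lunit !tmorMr !compcA zig tmor1.
Qed.

(** As for [tensr_triL], reduced to the zigzag identity of Y. *)
Lemma tensr_triR B :
  (tensr_counit B \otm idc Y) \oc tensr_unit (B \ot Y) = idc (B \ot Y).
Proof.
have [_ zag] := XY.
rewrite /tensr_counit /tensr_unit -!tmorMl.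
have pent : (tass B Y X \otm idc Y) \oc (tassV (B \ot Y) X Y \oc tassV B Y (X \ot Y)) =
    tassV B (Y \ot X) Y \oc (idc B \otm tassV Y X Y).
  by rewrite rev_pentagon !compcA (tmor_inverse1 _ (tassK _ _ _)).2 comp1c.
have runit : trunV (B \ot Y) = tassV B Y tunit \oc (idc B \otm trunV Y).
  rewrite -[LHS]comp1c -(tassK B Y tunit).1 -compcA; congr (_ \oc _).
  rewrite -[RHS]compc1; apply: (inv_postl (tmor1_inverse B (trunK Y))).
  by rewrite compcA -trun_tensor (trunK _).2.
rewrite runit -!compcA (compcA (idc (B \ot Y) \otm coev)) -tmor1 -tassV_nat.
rewrite -!compcA (compcA (tassV (B \ot Y) X Y)) (compcA (tass B Y X \otm _)) pent.
rewrite -!compcA (compcA ((idc B \otm ev) \otm _)) -tassV_nat -!compcA.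
by rewrite (compcA (trun B \otm _)) rev_triangle !tmorMr !compcA zag tmor1.
Qed.

Definition tensr_adjunction : adjunction (tensr X) (tensr Y) :=
  @Adjunction _ _ (tensr X) (tensr Y)
    (@NatTrans _ _ (id_functor M) (comp_functor (tensr Y) (tensr X)) tensr_unit
      tensr_unit_nat)
    (@NatTrans _ _ (comp_functor (tensr X) (tensr Y)) (id_functor M) tensr_counit
      tensr_counit_nat)
    tensr_triL tensr_triR.

Lemma tensr_adj_rE A B (f : Hom (A \ot X) B) :
  adj_r tensr_adjunction f = (f \otm idc Y) \oc tensr_unit A.
Proof. by []. Qed.

(** The natural maps Hom(X, B) -> Hom(1, B \ot Y) and, below,
    Hom(Y, B) -> Hom(1, X \ot B) of a dual pair.  Only the coevaluation occurs in
    them, which keeps the unit and associativity constraints out of all later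
    computations. *)
Definition dual_r B (q : Hom X B) : Hom tunit (B \ot Y) := (q \otm idc Y) \oc coev.

(** It is the adjunction bijection of [tensr_adjunction] at A = 1, up to the
    unitor of X. *)
Lemma dual_r_bijective B : bijective (@dual_r B).
Proof.
have dualE q : dual_r q = adj_r tensr_adjunction (q \oc tlun X) :> Hom _ (B \ot Y).
  rewrite /dual_r [RHS]tensr_adj_rE -tmorMl -compcA; congr (_ \oc _).
  rewrite /tensr_unit 2!compcA -tlun_tensor tlun_nat tlun_trun_unit.
  by rewrite -compcA (trunK _).2 compc1.
exists (fun p => adj_l tensr_adjunction p \oc tlunV X) => q.
  by rewrite dualE (adj_rK tensr_adjunction) -compcA (tlunK X).2 compc1.
rewrite dualE -compcA (tlunK X).1 compc1.
exact: (adj_lK tensr_adjunction).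
Qed.

Lemma dual_r_linear B : hom_linear (@dual_r B).
Proof. by move=> a f g; rewrite /dual_r [_ \otm _]tmor_linl; apply: comp_linear_l. Qed.

Lemma dual_r_post B B' (g : Hom B B') (q : Hom X B) :
  dual_r (g \oc q) = (g \otm idc Y) \oc dual_r q.
Proof. by rewrite /dual_r -tmorMl compcA. Qed.

Definition dual_l B (v : Hom Y B) : Hom tunit (X \ot B) := (idc X \otm v) \oc coev.

Lemma dual_l_linear B : hom_linear (@dual_l B).
Proof. by move=> a f g; rewrite /dual_l [_ \otm _]tmor_linr; apply: comp_linear_l. Qed.

Lemma dual_l_post B B' (g : Hom B B') (v : Hom Y B) :
  dual_l (g \oc v) = (idc X \otm g) \oc dual_l v.
Proof. by rewrite /dual_l -tmorMr compcA. Qed.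

End TensorAdjunction.

(** The mirror image of [dual_r_bijective]. *)
Lemma dual_l_bijective (k : fieldType) (M : monoidalLinCat k) (X Y : M)
    (ev : Hom (Y \ot X) tunit) (coev : Hom tunit (X \ot Y)) B :
  dual_pair ev coev -> bijective (@dual_l k M X Y coev B).
Proof. by move=> /dual_pair_rev XY; apply: (dual_r_bijective XY). Qed.

(** * Nakayama pairings in a finite tensor category *)

Section Mates.
Variables (k : fieldType) (M : monoidalLinCat k).

(** The bijection Hom(X, 1) -> Hom(1, Y) for a dual Y of X. *)
Definition dual_form (X Y : M) (coev : Hom tunit (X \ot Y)) (q : Hom X tunit) :
    Hom tunit Y := tlun Y \oc dual_r coev q.

Lemma dual_form_linear (X Y : M) (coev : Hom tunit (X \ot Y)) :
  hom_linear (dual_form coev).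
Proof.
by move=> a f g; rewrite /dual_form [dual_r _ _]dual_r_linear; apply: comp_linear_r.
Qed.

Lemma dual_form_bijective (X Y : M) (ev : Hom (Y \ot X) tunit)
    (coev : Hom tunit (X \ot Y)) : dual_pair ev coev -> bijective (dual_form coev).
Proof.
move=> XY; have [g gK Kg] := dual_r_bijective XY tunit.
exists (fun p => g (tlunV Y \oc p)) => q; rewrite /dual_form.
  by rewrite compcA (tlunK Y).1 comp1c gK.
by rewrite Kg compcA (tlunK Y).2 comp1c.
Qed.

Section TwoPairs.
Variables (X Y : M) (ev : Hom (Y \ot X) tunit) (coev : Hom tunit (X \ot Y)).
Variables (X' Y' : M) (ev' : Hom (Y' \ot X') tunit) (coev' : Hom tunit (X' \ot Y')).
Hypotheses (XY : dual_pair ev coev) (XY' : dual_pair ev' coev').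

(** [h] is the dual morphism of [g], in terms of coevaluations only. *)
Definition mates (g : Hom X X') (h : Hom Y' Y) := dual_r coev g = dual_l coev' h.

Lemma left_mate g : exists h, mates g h.
Proof.
by have [l _ lK] := dual_l_bijective Y XY'; exists (l (dual_r coev g)); rewrite /mates lK.
Qed.

Lemma right_mate h : exists g, mates g h.
Proof.
have [l _ lK] := dual_r_bijective XY X'.
by exists (l (dual_l coev' h)); rewrite /mates lK.
Qed.

Lemma mates_dual_l g h B (v : Hom Y B) : mates g h ->
  dual_l coev' (v \oc h) = (g \otm idc B) \oc dual_l coev v.
Proof. by move=> gh; rewrite dual_l_post -gh /dual_r /dual_l !compcA tmor_swap. Qed.

Lemma mates_dual_form g h (q : Hom X' tunit) : mates g h ->
  dual_form coev (q \oc g) = h \oc dual_form coev' q.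
Proof.
move=> gh; rewrite /dual_form dual_r_post gh /dual_l /dual_r.
rewrite (compcA (q \otm _)) -tmor_swap -!compcA compcA tlun_nat.
by rewrite -!compcA.
Qed.

End TwoPairs.
End Mates.

Definition rev_tensor (k : fieldType) (C : finTensCat k) : finTensCat k :=
  @FinTensCat k (rev C) (@rdual k C) (@rdual_ev k C) (@rdual_coev k C)
    (fun X => dual_pair_rev (rdualP X)) (@ldual k C) (@ldual_ev k C)
    (@ldual_coev k C) (fun X => dual_pair_rev (ldualP X)) (ftc_finite C).

Section FiniteTensor.
Variables (k : fieldType) (C : finTensCat k).
Implicit Types X Y Z I alpha : C.

Lemma projective_tensr I Z : projective I -> projective (I \ot Z).
Proof.
apply: (left_adjoint_projective (tensr_adjunction (ldualP Z))
  (tensr_adjunction (ldualP (ldual Z)))).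
exact: tensr_linear.
Qed.

End FiniteTensor.

Section FiniteTensorDuals.
Variables (k : fieldType) (C : finTensCat k).
Implicit Types X Y Z I alpha : C.

Lemma projective_tensl I Z : projective I -> projective (Z \ot I).
Proof. exact: (@projective_tensr k (rev_tensor C) I Z). Qed.

(** By the zigzag identity, I^* is a retract of I^* \ot I \ot I^*, which is
    projective because I is. *)
Lemma projective_ldual I : projective I -> projective (ldual I).
Proof.
move=> projI.
have proj : projective (ldual I \ot I \ot ldual I).
  exact/projective_tensr/projective_tensl.
have [_ zag] := ldualP I.
apply: (retract_projective (r := tlun _ \oc (ldual_ev I \otm idc _))
  (s := tassV _ _ _ \oc ((idc _ \otm ldual_coev I) \oc trunV _)) _ proj).
by rewrite -[RHS]zag !compcA.
Qed.

Lemma tensor_generator : exists Q : C, generator Q.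
Proof. exact/finite_generator/ftc_finite. Qed.

(** Hom(I, alpha \ot Z^* ) = Hom(I \ot Z, alpha) is dual to
    Hom(1, I \ot Z) = Hom( ^*Z, I). *)
Lemma nakayama_tensor alpha Z :
  nakayama tunit alpha -> nakayama (rdual Z) (alpha \ot ldual Z).
Proof.
move=> nak.
apply: (nakayama_transport (G := tensr Z) (p := fun I => @dual_r _ _ _ _ (rdual_coev Z) I)
  (q := fun I x => adj_l (tensr_adjunction (ldualP Z)) x) nak).
- by move=> I; apply: projective_tensr.
- by move=> I; apply: dual_r_linear.
- by move=> I; apply: dual_r_bijective (rdualP Z) I.
- by move=> I J g z; apply: dual_r_post.
- by move=> I; apply/adj_l_linear/tensr_linear.
- move=> I; exists (fun y => adj_r (tensr_adjunction (ldualP Z)) y) => y.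
    exact: adj_lK.
  exact: adj_rK.
- by move=> I J g x; apply: adj_l_pre.
Qed.

(** Evaluating the pairing of alpha at I^* and exchanging the two sides:
    Hom( ^*alpha, I) = Hom(1, I \ot alpha) = Hom(I^*, alpha) is dual to
    Hom(1, I^* ) = Hom(I, 1). *)
Lemma nakayama_ldual alpha : nakayama tunit alpha -> nakayama (rdual alpha) tunit.
Proof.
move=> [b [bP bE]].
have dl I : {l : Hom tunit (I \ot alpha) -> Hom (ldual I) alpha |
    cancel (@dual_l _ _ _ _ (ldual_coev I) alpha) l /\
    cancel l (@dual_l _ _ _ _ (ldual_coev I) alpha)}.
  by apply: cid; have [l lK Kl] := dual_l_bijective alpha (ldualP I); exists l.
pose l I := projT1 (dl I).
have lK I : cancel (@dual_l _ _ _ _ (ldual_coev I) alpha) (l I).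
  exact: (projT2 (dl I)).1.
have Kl I : cancel (l I) (@dual_l _ _ _ _ (ldual_coev I) alpha).
  exact: (projT2 (dl I)).2.
pose q I (p : Hom (rdual alpha) I) := l I (dual_r (rdual_coev alpha) p).
pose f I := @dual_form _ _ _ _ (ldual_coev I).
exists (fun I p x => b (ldual I) (f I x) (q I p)).
split=> [I projI|I J g p x projI projJ].
  apply: perfect_flip.
  apply: (hom_perfect_transport (bP _ (projective_ldual projI))).
  - exact: dual_form_linear.
  - exact: dual_form_bijective (ldualP I).
  - move=> a u v; rewrite /q [dual_r _ _]dual_r_linear.
    have l_lin : hom_linear (l I).
      by apply: hom_linear_can (lK I) (Kl I); apply: dual_l_linear.
    exact: l_lin.
  - have [m mK Km] := dual_r_bijective (rdualP alpha) I.
    exists (fun x => m (dual_l (ldual_coev I) x)) => x; rewrite /q.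
      by rewrite Kl mK.
    by rewrite Km lK.
have [h gh] := left_mate (ldual_coev I) (ldualP J) g.
rewrite /f (mates_dual_form x gh) bE; [|exact: projective_ldual..].
congr (b _ _ _); rewrite /q dual_r_post -[RHS]lK.
by rewrite (mates_dual_l _ gh) Kl.
Qed.

(** Both sides are Nakayama values at the right dual of alpha. *)
Lemma nakayama_unit_right_inverse alpha : nakayama tunit alpha ->
  isomorphic (alpha \ot ldual alpha) (tunit : C).
Proof.
move=> nak; have [Q QP] := tensor_generator.
exact: nakayama_unique QP (nakayama_tensor alpha nak) (nakayama_ldual nak).
Qed.

End FiniteTensorDuals.

(** * The modular object *)

Section DualGenerator.
Variables (k : fieldType) (C : finTensCat k) (Q : C).
Hypothesis QP : generator Q.
Implicit Types M X Y : C.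

Let P : C := rdual Q.
Let coevP : Hom tunit (P \ot Q) := rdual_coev Q.
Let PQ : dual_pair (rdual_ev Q) coevP := rdualP Q.

(** The next four lemmas say that P, the right dual of Q, generates through
    Hom(1, P \ot -) and cogenerates through Hom(-, P): duality identifies
    Hom(1, P \ot X) with Hom(Q, X), and Hom(M, P) with Hom(Q, M^* ). *)
Lemma dual_gen_faithful X Y (f f' : Hom X Y) :
  (forall p : Hom tunit (P \ot X), (idc P \otm f) \oc p = (idc P \otm f') \oc p) ->
  f = f'.
Proof.
move=> e; apply: (gen_faithful QP) => x.
by apply: (bij_inj (dual_l_bijective Y PQ)); rewrite !dual_l_post e.
Qed.

Lemma dual_gen_full X Y (phi : Hom tunit (P \ot X) -> Hom tunit (P \ot Y)) :
  hom_linear phi ->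
  (forall (a : Hom P P) p, phi ((a \otm idc X) \oc p) = (a \otm idc Y) \oc phi p) ->
  exists f : Hom X Y, forall p, phi p = (idc P \otm f) \oc p.
Proof.
move=> phi_lin phiE.
have [l lK Kl] := dual_l_bijective Y PQ.
have l_lin : hom_linear l by apply: hom_linear_can lK Kl; apply: dual_l_linear.
have [||f fE] := gen_full QP (phi := fun x => l (phi (dual_l coevP x))).
- by move=> c x y; rewrite [dual_l _ _]dual_l_linear [phi _]phi_lin; apply: l_lin.
- move=> x a; have [g ga] := right_mate coevP PQ a.
  by rewrite (mates_dual_l x ga) phiE -[RHS]lK (mates_dual_l _ ga) Kl.
exists f => p; have [m mK Km] := dual_l_bijective X PQ.
by rewrite -(Km p) -dual_l_post -fE Kl.
Qed.

Lemma dual_cogen_faithful M X (p p' : Hom tunit (M \ot X)) :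
  (forall g : Hom M P, (g \otm idc X) \oc p = (g \otm idc X) \oc p') -> p = p'.
Proof.
move=> e; have [m mK Km] := dual_l_bijective X (ldualP M).
rewrite -(Km p) -(Km p'); congr dual_l; apply: (gen_faithful QP) => h.
have [g gh] := right_mate coevP (ldualP M) h.
apply: (bij_inj (dual_l_bijective X PQ)).
by rewrite !(mates_dual_l _ gh) !Km e.
Qed.

Lemma dual_cogen_full M X (phi : Hom M P -> Hom tunit (P \ot X)) :
  hom_linear phi ->
  (forall (a : Hom P P) g, phi (a \oc g) = (a \otm idc X) \oc phi g) ->
  exists p : Hom tunit (M \ot X), forall g, phi g = (g \otm idc X) \oc p.
Proof.
move=> phi_lin phiE.
have [l lK Kl] := dual_l_bijective X PQ.
have l_lin : hom_linear l by apply: hom_linear_can lK Kl; apply: dual_l_linear.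
have [m mK Km] := dual_r_bijective (ldualP M) P.
have m_lin : hom_linear m by apply: hom_linear_can mK Km; apply: dual_r_linear.
have [||v vE] := gen_full QP (phi := fun h => l (phi (m (dual_l coevP h)))).
- move=> c x y; rewrite [dual_l _ _]dual_l_linear [m _]m_lin [phi _]phi_lin.
  exact: l_lin.
- move=> h a; have [g ga] := right_mate coevP PQ a.
  rewrite (mates_dual_l h ga) -{1}(Km (dual_l coevP h)) -dual_r_post mK phiE.
  by rewrite -[RHS]lK (mates_dual_l _ ga) Kl.
exists (dual_l (ldual_coev M) v) => g.
have [h gh] := left_mate (ldual_coev M) PQ g.
by rewrite -(mates_dual_l v gh) -vE Kl -gh mK.
Qed.

End DualGenerator.

Section ModularObject.
Variables (k : fieldType) (C : finTensCat k) (cop : copowers C) (Q alpha : C).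
Hypothesis QP : generator Q.
Let P : C := rdual Q.
Variable beta : Hom P tunit -> Hom tunit (P \ot alpha) -> k.
Hypothesis betaP : hom_perfect beta.
Hypothesis betaE : forall (a : Hom P P) q p,
  beta (q \oc a) p = beta q ((a \otm idc alpha) \oc p).

Let V (M : C) := linear_dual (homV M tunit).

(** As Hom(1, P \ot alpha) is the dual of Hom(P, 1), a functional phi on
    Hom(M, 1) prescribes the images in P \ot alpha, along all g : M -> P, of a
    point of M \ot alpha. *)
Definition coefficient M (phi : V M) (p : Hom tunit (M \ot alpha)) :=
  forall (g : Hom M P) (q : Hom P tunit),
  beta q ((g \otm idc alpha) \oc p) = phi (q \oc g).

(** The prescribed family is End(P)-equivariant, so [dual_cogen_full] applies. *)
Lemma coefficient_exists M (phi : V M) : exists p, coefficient phi p.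
Proof.
have [||psi psi_lin psiE] := hom_perfect_map
  (beta := fun (q : Hom P tunit) (g : Hom M P) => phi (q \oc g)) betaP.
- by move=> g a x y; rewrite [_ \oc _]comp_linear_l linearP.
- by move=> q a x y; rewrite [_ \oc _]comp_linear_r linearP.
have [|p pE] := dual_cogen_full QP psi_lin.
  move=> a g; apply: (hom_perfect_inj betaP) => q.
  by rewrite -betaE -!psiE compcA.
by exists p => g q; rewrite -pE psiE.
Qed.

Lemma coefficient_unique M (phi : V M) p p' :
  coefficient phi p -> coefficient phi p' -> p = p'.
Proof.
move=> pP p'P; apply: (dual_cogen_faithful QP) => g.
by apply: (hom_perfect_inj betaP) => q; rewrite pP p'P.
Qed.

Definition coef M (phi : V M) : homV tunit (M \ot alpha) :=
  projT1 (cid (coefficient_exists phi)).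

Lemma coefP M (phi : V M) : coefficient phi (coef phi).
Proof. exact: projT2 (cid (coefficient_exists phi)). Qed.

Lemma coef_linear M : linear (@coef M).
Proof.
move=> a phi psi; apply: coefficient_unique (coefP _) _ => g q.
have [_ linr _ _] := betaP.
by rewrite [_ \oc _]comp_linear_r linr !coefP add_lfunE scale_lfunE.
Qed.

Lemma coef_nat M M' (g : Hom M M') (phi : V M) :
  (g \otm idc alpha) \oc coef phi = coef (dual_map (precomp tunit g) phi).
Proof.
apply: coefficient_unique (coefP _) => g' q.
by rewrite compcA tmorMl coefP dual_mapE comp_lfunE precompE compcA.
Qed.

Lemma universal_nat M M' (g : Hom M M') :
  copw_from cop (lfun_of (@coef_linear M')) \oc fmap (J_rex cop) g =
  fmap (cayley_obj alpha) g \oc copw_from cop (lfun_of (@coef_linear M)).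
Proof.
apply: (@copw_inj _ _ cop); rewrite copw_to_map copw_nat !copw_fromK.
apply/lfunP => phi; rewrite !comp_lfunE postcompE !(lfun_ofE (@coef_linear _)).
exact/esym/coef_nat.
Qed.

Definition universal : Hom (J_rex cop : Rex C) (cayley C alpha) :=
  @NatTrans C C (J_rex cop) (cayley_obj alpha)
    (fun M => copw_from cop (lfun_of (@coef_linear M))) universal_nat.

Lemma copw_toK_universal M (phi : V M) :
  copw_to cop (universal M) phi = coef phi.
Proof. by rewrite copw_fromK (lfun_ofE (@coef_linear _)). Qed.

(** At M = P the map Hom(P, 1)^* -> Hom(1, P \ot Y) of t is an equivariant map out
    of Hom(1, P \ot alpha), hence is induced by a unique f.  Naturality along all
    g : M -> P then determines t at every M. *)
Lemma universalP (Y : C) (t : Hom (J_rex cop : Rex C) (cayley C Y)) :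
  exists! f : Hom alpha Y, fmap (cayley C) f \oc universal = t.
Proof.
pose T M (phi : V M) : Hom tunit (M \ot Y) := copw_to cop (t M) phi.
have T_lin M : linear (T M : V M -> homV tunit (M \ot Y)).
  by move=> a x y; rewrite /T linearP.
have T_nat M M' (g : Hom M M') phi :
    T M' (phi \o precomp tunit g)%VF = (g \otm idc Y) \oc T M phi.
  have /(congr1 (fun u => copw_to cop u phi)) := ncomp_nat t g.
  by rewrite copw_to_map copw_nat !comp_lfunE dual_mapE postcompE.
have [linl linr _ _] := betaP.
pose ev (p : Hom tunit (P \ot alpha)) : V P := lfun_of (linl p).
have evE p q : ev p q = beta q p by apply: (lfun_ofE (linl p)).
have coef_ev p : coef (ev p) = p.
  by apply: coefficient_unique (coefP _) _ => g q; rewrite evE betaE.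
have [||f fE] := dual_gen_full QP (phi := fun p => T P (ev p)).
- move=> a x y; rewrite -[RHS]T_lin; congr T; apply/lfunP => q.
  by rewrite add_lfunE scale_lfunE !evE linr.
- move=> a p; rewrite -T_nat; congr T; apply/lfunP => q.
  by rewrite comp_lfunE precompE !evE betaE.
have fT M (phi : V M) : (idc M \otm f) \oc coef phi = T M phi.
  apply: (dual_cogen_faithful QP) => g.
  rewrite -T_nat compcA -tmor_swap -compcA -fE; congr T; apply/lfunP => q.
  by rewrite evE coefP comp_lfunE precompE.
exists f; split=> [|f' f'E].
  apply: nattransP => M; apply: (@copw_inj _ _ cop); apply/lfunP => phi.
  by rewrite copw_nat comp_lfunE copw_toK_universal postcompE -[RHS]fT.
apply: (dual_gen_faithful QP) => p.
rewrite -(coef_ev p) fT /T -f'E.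
by rewrite [in LHS]copw_nat comp_lfunE copw_toK_universal postcompE.
Qed.

End ModularObject.

Lemma adj_unit_universal (C D : category) (G : functor C D) (H : functor D C)
    (adj : adjunction G H) X Y (t : Hom X (H Y)) :
  exists! f : Hom (G X) Y, fmap H f \oc adj_unit adj X = t.
Proof.
exists (adj_l adj t); split=> [|f <-]; first exact: adj_lK.
exact: adj_rK.
Qed.

Lemma universal_arrow_unique (C D : category) (H : functor D C) (X : C) (A B : D)
    (u : Hom X (H A)) (v : Hom X (H B)) :
  (forall Y (t : Hom X (H Y)), exists! f : Hom A Y, fmap H f \oc u = t) ->
  (forall Y (t : Hom X (H Y)), exists! f : Hom B Y, fmap H f \oc v = t) ->
  isomorphic A B.
Proof.
move=> uP vP; have [f [fE _]] := uP B v; have [g [gE _]] := vP A u.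
exists f, g; split.
  have [h [_ hU]] := uP A u.
  by rewrite -(hU (idc A)) ?fmap1 ?comp1c // -(hU (g \oc f)) // fmapM -compcA fE gE.
have [h [_ hU]] := vP B v.
by rewrite -(hU (idc B)) ?fmap1 ?comp1c // -(hU (f \oc g)) // fmapM -compcA gE fE.
Qed.

(** An object with the pairing exists; it receives a universal arrow from
    J, and so does the modular object. *)
Lemma nakayama_modular_object (k : fieldType) (C : finTensCat k) (cop : copowers C)
    (Ups : functor (Rex C) C) (adj : adjunction Ups (cayley C)) :
  nakayama tunit (modular_object cop Ups).
Proof.
have [Q QP] := tensor_generator C.
have [alpha nak] := nakayama_exists tunit QP.
suff alphaE : isomorphic alpha (modular_object cop Ups).
  exact: isomorphic_nakayama (isomorphic_refl _) alphaE nak.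
have [b [bP bE]] := nakayama_ldual nak.
have projP : projective (rdual Q).
  exact: (@projective_ldual k (rev_tensor C) Q (generator_projective QP)).
have [d dK Kd] := dual_r_bijective (rdualP alpha) (rdual Q).
have d_lin : hom_linear d by apply: hom_linear_can dK Kd; apply: dual_r_linear.
pose beta (q : Hom (rdual Q) tunit) p := b (rdual Q) (d p) q.
have betaP : hom_perfect beta.
  apply: perfect_flip; apply: (hom_perfect_transport (q := id) (bP _ projP)) => //.
  - by exists (@dual_r _ _ _ _ (rdual_coev alpha) _).
  - by exists id.
have betaE (a : Hom (rdual Q) (rdual Q)) q p :
    beta (q \oc a) p = beta q ((a \otm idc alpha) \oc p).
  by rewrite /beta -bE // -{2}(Kd p) -dual_r_post dK.
exact: (universal_arrow_unique (H := cayley C)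
  (u := universal cop QP betaP betaE) (v := adj_unit adj (J_rex cop : Rex C))
  (universalP QP betaP betaE) (adj_unit_universal adj (X := J_rex cop))).
Qed.

(** * Invertible objects *)

Section Inverses.
Variables (k : fieldType) (M : monoidalLinCat k).
Implicit Types X Y Z : M.

Definition invertible X Y := isomorphic (X \ot Y) tunit /\ isomorphic (Y \ot X) tunit.

Lemma nat_isomorphic_tensr X Y : isomorphic (X \ot Y) tunit ->
  nat_isomorphic (comp_functor (tensr Y) (tensr X)) (id_functor M).
Proof.
move=> [f [g fg]].
have nat_a A B (h : Hom A B) :
    trun B \oc (idc B \otm f) \oc tass B X Y \oc ((h \otm idc X) \otm idc Y) =
    h \oc (trun A \oc (idc A \otm f) \oc tass A X Y).
  rewrite -compcA tass_nat tmor1 !compcA -(compcA (trun B)) tmor_swap.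
  by rewrite !compcA trun_nat.
have aK A : inverse_pair (trun A \oc (idc A \otm f) \oc tass A X Y)
    (tassV A X Y \oc (idc A \otm g) \oc trunV A).
  have [tK Kt] := tassK A X Y; have [rK Kr] := trunK A.
  have [fK Kf] := tmor1_inverse A fg.
  split; rewrite !compcA.
    rewrite -(compcA _ (trunV A)) rK compc1 -(compcA (tassV A X Y)) fK compc1.
    exact: tK.
  rewrite -(compcA _ (tass A X Y)) Kt compc1 -(compcA (trun A)) Kf compc1.
  exact: Kr.
exists (@NatTrans _ _ (comp_functor (tensr Y) (tensr X)) (id_functor M) _ nat_a).
have nat_b A B (h : Hom A B) :
    tassV B X Y \oc (idc B \otm g) \oc trunV B \oc h =
    ((h \otm idc X) \otm idc Y) \oc (tassV A X Y \oc (idc A \otm g) \oc trunV A).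
  exact: inverse_square (aK _) (aK _) (nat_a _ _ h).
by exists (@NatTrans _ _ (id_functor M) (comp_functor (tensr Y) (tensr X)) _ nat_b).
Qed.

Lemma tensr_equivalence X Y : isomorphic (X \ot Y) tunit ->
  isomorphic (Y \ot X) tunit -> is_equivalence (tensr X).
Proof. by move=> XY YX; exists (tensr Y); split; apply: nat_isomorphic_tensr. Qed.

(** Tensoring with W is an equivalence with inverse - \ot V, so the
    isomorphism 1 = V \ot W is a universal arrow to - \ot W; so is the
    coevaluation of X. *)
Lemma inverse_is_right_dual X W V (ev : Hom (W \ot X) tunit)
    (coev : Hom tunit (X \ot W)) : dual_pair ev coev ->
  isomorphic (W \ot V) tunit -> isomorphic (V \ot W) tunit -> isomorphic X V.
Proof.
move=> XW WV VW; have [f [g [gf fg]]] := VW.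
have ff := equivalence_fully_faithful (tensr_equivalence WV VW).
have u1 (B : M) (t : Hom tunit (tensr W B)) :
    exists! q : Hom X B, fmap (tensr W) q \oc coev = t.
  have [l lK Kl] := dual_r_bijective XW B.
  by exists (l t); split=> [|q <-]; [apply: Kl|apply: lK].
have u2 (B : M) (t : Hom tunit (tensr W B)) :
    exists! q : Hom V B, fmap (tensr W) q \oc g = t.
  have [q [qE qU]] := ff V B (t \oc f); exists q; split=> [|q' q'E].
    by rewrite qE -compcA fg compc1.
  by apply: qU; rewrite -q'E -compcA gf compc1.
exact: (universal_arrow_unique (H := tensr W) (u := coev) (v := g) u1 u2).
Qed.

End Inverses.

(** * Modular objects and tensor functors *)

#[local] Instance isomorphic_equivalence (C : category) : Equivalence (@isomorphic C).
Proof.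
split; [exact: isomorphic_refl | exact: isomorphic_sym | exact: isomorphic_trans].
Qed.

#[local] Hint Resolve isomorphic_refl : core.

#[local] Instance tensor_proper (k : fieldType) (M : monoidalLinCat k) :
  Proper (@isomorphic M ==> @isomorphic M ==> @isomorphic M) (@tobj k M).
Proof. by move=> X X' eX Y Y' eY; apply: tensor_isomorphic. Qed.

Section Invertible.
Variables (k : fieldType) (C : finTensCat k).
Implicit Types X Y : C.

(** The left dual gives a right inverse; the reversed tensor product turns this
    into a left inverse given by the right dual, and the two inverses agree. *)
Lemma nakayama_unit_invertible (alpha : C) :
  nakayama tunit alpha -> invertible alpha (ldual alpha).
Proof.
move=> nak; have right_inv := nakayama_unit_right_inverse nak.
have left_inv : isomorphic (rdual alpha \ot alpha) tunit.
  exact: (@nakayama_unit_right_inverse k (rev_tensor C) alpha nak).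
have e : isomorphic (ldual alpha) (rdual alpha).
  transitivity (rdual alpha \ot (alpha \ot ldual alpha)).
    by rewrite -tensor_isoA left_inv tensor_iso1l.
  by rewrite right_inv tensor_iso1r.
by split=> //; rewrite e.
Qed.

(** Both duals of Y are isomorphic to X.  [nakayama_tensor] at Y, for the
    tensor product and for its reverse, thus makes alpha \ot X and X \ot alpha
    both Nakayama values at X. *)
Lemma nakayama_unit_central (alpha X Y : C) :
  nakayama tunit alpha -> invertible X Y ->
  isomorphic (alpha \ot X) (X \ot alpha).
Proof.
move=> nak [XY YX]; have [Q QP] := tensor_generator C.
have rY : isomorphic (rdual Y) X := inverse_is_right_dual (rdualP Y) YX XY.
have lY : isomorphic (ldual Y) X.
  exact: (@inverse_is_right_dual k (rev C) _ _ _ _ _ (dual_pair_rev (ldualP Y)) XY YX).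
have nakr := nakayama_tensor Y nak.
have nakl := @nakayama_tensor k (rev_tensor C) alpha Y nak.
apply: (nakayama_unique QP (Z := X)).
  by apply: isomorphic_nakayama nakr; rewrite ?rY ?lY.
apply: isomorphic_nakayama nakl; first exact: lY.
by rewrite -[X in _ _ (X \ot _)]rY.
Qed.

End Invertible.

Section RelativeModularObject.
Variables (k : fieldType) (C D : finTensCat k) (F : tensorFunctor C D).

Lemma tensorFunctor_invertible (X Y : C) :
  invertible X Y -> invertible (F X) (F Y).
Proof.
have F1 : isomorphic (F tunit) tunit.
  by apply: isomorphic_sym; exists (tf_unit F), (tf_unitV F); apply: tf_unitK.
have FM (A B : C) : isomorphic (F A \ot F B) (F (A \ot B)).
  by exists (tf_mul F A B), (tf_mulV F A B); apply: tf_mulK.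
by move=> [XY YX]; split; rewrite FM -F1; apply: functor_isomorphic.
Qed.

Variables (L R : functor D C) (adjLF : adjunction L F) (adjFR : adjunction F R).

(** The functor L(- \ot chi) preserves projectives and has right adjoint
    F(-) \ot chi^*; being isomorphic to R, it also has F as a left adjoint. *)
Lemma nakayama_relative (alpha : C) (chi : D) :
  is_relative_modular_object L R chi -> nakayama tunit alpha ->
  nakayama tunit (F alpha \ot ldual chi).
Proof.
move=> [a [a' aK]] nak; pose G := comp_functor L (tensr chi).
have adj_chi := tensr_adjunction (ldualP chi).
apply: (nakayama_transport (G := G)
  (p := fun I z => a I \oc adj_r adjFR (z \oc tf_unitV F))
  (q := fun I x => adj_l adjLF (adj_l adj_chi x)) nak).
- move=> I projI; apply: (left_adjoint_projective adjLF adjFR (tf_lin F)).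
  exact: projective_tensr.
- have r_lin Y : hom_linear (@adj_r _ _ _ _ adjFR tunit Y).
    exact: adj_r_linear_of_left (tf_lin F).
  move=> I c x y; rewrite [_ \oc tf_unitV F]comp_linear_l [adj_r _ _]r_lin.
  exact: comp_linear_r.
- move=> I; exists (fun z => adj_l adjFR (a' I \oc z) \oc tf_unit F) => z.
    by rewrite compcA (aK I).1 comp1c adj_rK -compcA (tf_unitK F).1 compc1.
  by rewrite -compcA (tf_unitK F).2 compc1 adj_lK compcA (aK I).2 comp1c.
- move=> I J g z; rewrite -[g \oc z \oc _]compcA adj_r_post !compcA.
  by rewrite (ncomp_nat a g).
- have l_lin X : hom_linear (@adj_l _ _ _ _ adjLF X alpha).
    exact: adj_l_linear_of_right (tf_lin F).
  move=> I c x y; rewrite [adj_l adj_chi _](adj_l_linear adj_chi (@tensr_linear _ _ chi)).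
  exact: l_lin.
- move=> I; exists (fun y => adj_r adj_chi (adj_r adjLF y)) => y.
    by rewrite !adj_lK.
  by rewrite !adj_rK.
- by move=> I J g x; rewrite !adj_l_pre.
Qed.

End RelativeModularObject.

Theorem theorem4p8 (k : fieldType) (C D : finTensCat k)
    (F : tensorFunctor C D) (F_exact : exact_functor F)
    (L R : functor D C) (adjLF : adjunction L F) (adjFR : adjunction F R)
    (F_perfect : has_left_adjoint L \/ has_right_adjoint R \/
                 exists chi : D, is_relative_modular_object L R chi)
    (chi_F : D) (chi_FP : is_relative_modular_object L R chi_F)
    (copC : copowers C) (UpsC : functor (Rex C) C)
    (adjUpsC : adjunction UpsC (cayley C))
    (copD : copowers D) (UpsD : functor (Rex D) D)
    (adjUpsD : adjunction UpsD (cayley D)) :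
  let alpha_C := modular_object copC UpsC in
  let alpha_D := modular_object copD UpsD in
  isomorphic (ldual alpha_D \ot F alpha_C) chi_F /\
  isomorphic chi_F (F alpha_C \ot ldual alpha_D).
Proof.
move=> alpha_C alpha_D.
have nakC := nakayama_modular_object copC adjUpsC.
have nakD := nakayama_modular_object copD adjUpsD.
have [Q QP] := tensor_generator D.
have chiE : isomorphic (F alpha_C \ot ldual chi_F) alpha_D.
  exact: nakayama_unique QP (nakayama_relative adjLF adjFR chi_FP nakC) nakD.
have FaC := tensorFunctor_invertible F (nakayama_unit_invertible nakC).
have aFaC := nakayama_unit_central nakD FaC.
have [aD aD'] := nakayama_unit_invertible nakD.
have [cc' c'c] := FaC.
move: aFaC chiE cc' c'c aD aD'; rewrite -/alpha_C -/alpha_D.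
set a := alpha_D; set a' := ldual a; set c := F alpha_C; set c' := F _.
move=> ac chiE cc' c'c aa' a'a.
(* chi^* is the product c^-1 a, hence invertible with inverse a^-1 c, and an
   object is recovered from its invertible left dual as the inverse. *)
have chiP : isomorphic chi_F (a' \ot c).
  apply: (inverse_is_right_dual (ldualP chi_F)).
    rewrite -(tensor_iso1l (ldual chi_F)) -c'c (tensor_isoA c') chiE.
    by rewrite -(tensor_isoA _ a') (tensor_isoA c') aa' tensor_iso1r.
  by rewrite (tensor_isoA a') chiE.
split; first by symmetry.
(* Insert a a^-1 on the right of a^-1 c and move a across c. *)
rewrite chiP -(tensor_iso1r (a' \ot c)) -aa' (tensor_isoA a') -(tensor_isoA c).
by rewrite -ac (tensor_isoA a) -(tensor_isoA a') a'a tensor_iso1l.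
Qed.
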